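(* Let $A$ be the attractor of a holomorphic IFS $(G,\Omega)$ where $G=(g_1,\dots,g_m)$. 1. If the strong separation condition holds, then $A$ is a $J$-like Cantor set. 2. Assume there exists an open set $U\subset\Omega$ such that $A\subset\overline{U}$, $A\cap U\neq\emptyset$, and the sets $g_i(U)$, $i=1,\dots,m$, are pairwise disjoint (the inclusions $g_i(U)\subset U$ are not assumed). Then every $g_i$ is a symmetry of $A$ on each component $D$ of $U$ that intersects $A$. 3. Assume that the strong open set condition holds with a set $O\subset\Omega$. Then for each component $D$ of $O$ that intersects $A$, any finite composition $g_{\mathbf{w}}=g_{i_1}\circ\dots\circ g_{i_k}$ of the $g_i$'s is a symmetry of $A$ on $D$, and $A$ is $J$-like relative to the domain $D$.
   Context: A holomorphic IFS is a pair $(G,\Omega)$ where $\Omega$ is a bounded domain in $\mathbb{C}$ and $G=\{g_i:\Omega\to\Omega\}$ is a finite collection of univalent (holomorphic injective) maps with $\overline{g_i(\Omega)}\subset\Omega$ for all $i$. (Each $g_i$ is then a strict contraction of $\Omega$ in its hyperbolic metric.) Its attractor is the unique non-empty compact set $A\subset\Omega$ with $A=\bigcup_{i}g_i(A)$; it is always assumed that $\#A\ge2$. Strong separation condition (SSC): $g_i(A)\cap g_j(A)=\emptyset$ for all $i\neq j$. Strong open set condition with $O$: $O$ is an open set with $A\cap O\neq\emptyset$, $g_i(O)\subset O$ for all $i$, and $g_i(O)\cap g_j(O)=\emptyset$ for all $i\ne j$. A holomorphic map $H:D\to\mathbb{C}$ on a domain $D$ with $D\cap A\neq\emptyset$ is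 a (local holomorphic) symmetry of $A$ on $D$ if for $x\in D$: $x\in D\cap A\Leftrightarrow H(x)\in H(D)\cap A$. A point $b\in D$ is an attracting fixed point of $H$ if $H(b)=b$ and $0<|H'(b)|<1$. $A$ is $J$-like relative to a domain $D$ if the set of points of $D\cap A$ that are attracting fixed points of local holomorphic symmetries of $A$ (each defined on some domain containing the point) is dense in $D\cap A$; $A$ is $J$-like if the set of points of $A$ that are attracting fixed points of local holomorphic symmetries of $A$ is dense in $A$. *)

(* Defs.v *)
From HB Require Import structures.
From mathcomp Require Import all_boot all_order all_algebra.
From mathcomp Require Import complex.
From mathcomp Require Import all_classical all_reals all_analysis.

Set Implicit Arguments.
Unset Strict Implicit.
Unset Printing Implicit Defensive.

Import Order.TTheory GRing.Theory Num.Theory.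
Import numFieldNormedType.Exports.

Local Open Scope classical_set_scope.
Local Open Scope ring_scope.

(* Viewing R[i] as a numClosedFieldType makes MathComp-Analysis equip it with
   the topology of its modulus and with its structure of normed module over
   itself, so that derivability over [CC R] is complex derivability. *)
Definition CC (R : realType) : numClosedFieldType := R[i].

Section HolomorphicIFS.
Context {R : realType}.
Implicit Types (A D U O Om : set (CC R)) (f H : CC R -> CC R) (z b : CC R).

Definition domain D := [/\ D !=set0, open D & connected D].

(* Maps defined on a subset of the plane are represented by total functions
   whose values outside that subset are irrelevant. *)
Definition holomorphic_on D f := forall z, D z -> derivable f z 1.

Definition univalent_on D f := holomorphic_on D f /\ set_inj D f.

Definition component U D := exists2 z, U z & D = connected_component U z.

Definition at_least_two A := exists x y, [/\ A x, A y & x <> y].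

(* The Cantor space is {0,1}^nat; [h] is the inverse homeomorphism. *)
Definition cantor_set A :=
  exists (f : cantor_space -> CC R) (h : CC R -> cantor_space),
    [/\ continuous f, f @` setT = A, cancel f h & {within A, continuous h}].

Definition symmetry A D H :=
  [/\ domain D, D `&` A !=set0, holomorphic_on D H &
      forall x, D x -> (D `&` A) x <-> (H @` D `&` A) (H x)].

(* The order of [CC R] compares complex numbers with the same imaginary part;
   between moduli it is the order of R. *)
Definition attracting_fixed_point D H b :=
  [/\ D b, H b = b & 0 < `|derive1 H b| < 1].

Definition attracting_points A : set (CC R) :=
  [set b | A b /\ exists D H, symmetry A D H /\ attracting_fixed_point D H b].

Definition J_like_relative A D :=
  D `&` A `<=` closure (D `&` attracting_points A).

Definition J_like A := A `<=` closure (attracting_points A).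

Section system.
Variables (m : nat) (g : 'I_m -> CC R -> CC R).

Definition holomorphic_IFS Om :=
  [/\ domain Om, bounded_set Om &
      forall i, [/\ g i @` Om `<=` Om, univalent_on Om (g i) &
                    closure (g i @` Om) `<=` Om]].

Definition attractor Om A :=
  [/\ A !=set0, compact A, A `<=` Om & A = \bigcup_i g i @` A].

Definition strong_separation A := trivIset setT (fun i => g i @` A).

Definition strong_open_set_condition A O :=
  [/\ open O, A `&` O !=set0, forall i, g i @` O `<=` O &
      trivIset setT (fun i => g i @` O)].

(* g_(i1) \o ... \o g_(ik) for the word w = [:: i1; ...; ik] *)
Definition word_map (w : seq 'I_m) : CC R -> CC R :=
  foldr (fun i f => g i \o f) id w.

End system.
End HolomorphicIFS.

(* Main.v *)
Require Import Defs.
From HB Require Import structures.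
From mathcomp Require Import all_boot all_order all_algebra.
From mathcomp Require Import complex ring lra.
From mathcomp Require Import all_classical all_reals all_analysis.

(* The analytic input is the maximum principle for functions that are merely
   complex differentiable.  By Goursat's argument such an [f] has a primitive
   [F] on squares; the difference quotients of [F] are twice differentiable, so
   a second-order test on the four points [z + t], [z - t], [z + i t], [z - i t]
   gives their maximum principle, which passes to [f].  Applied to
   [(f z - f p) / (z - p)], to [1 / (f - w)] and to
   [(z - zeta) / (f z - f zeta)], it yields the Cauchy estimate, the openness
   of univalent maps and the fact that their derivatives do not vanish.

   Since the closure of [g_i(Om)] is compact in [Om], pushing [g_i] slightly
   away from its value at a point keeps it a self-map of [Om] (Earle-Hamilton),
   so by the Cauchy estimate the derivatives of words of length [n] decay
   geometrically on compact sets.  Hence the pieces [g_w(A)] shrink, each [g_w]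
   has an attracting fixed point in [g_w(A)], and these points are dense in [A].

   If [x] is in [U] and [g_i x] is in [A] then [g_i x = g_j a] with [a] in [A];
   for [j <> i] the open set [g_i(U)] would contain [g_j a] and therefore meet
   [g_j(U)], because [a] is in the closure of [U].  So [j = i] and [x = a]
   belongs to [A].  Under strong separation the same holds near every point of
   [A] because the other pieces stay at a positive distance. *)

Set Implicit Arguments.
Unset Strict Implicit.
Unset Printing Implicit Defensive.

Import Order.TTheory GRing.Theory Num.Theory.
Import numFieldNormedType.Exports.

Local Open Scope classical_set_scope.
Local Open Scope ring_scope.

(** * Real modulus and coordinates of complex numbers *)

Section modulus.
Context {R : realType}.
Implicit Types z w : CC R.

(** The norm of [CC R] takes its values in [CC R], which is only partially ordered; this modulus
    lives in the ordered field [R], where estimates can be computed. *)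
Definition nr z : R := ComplexField.Normc.normc z.
Definition rc (x : R) : CC R := real_complex R x.
Definition iC : CC R := Complex 0 1.
Definition mkC (x y : R) : CC R := Complex x y.
Definition ReC z : R := complex.Re z.
Definition ImC z : R := complex.Im z.

Lemma norm_nr z : `|z| = rc (nr z).
Proof. by case: z => x y; rewrite /nr /rc normc_def. Qed.

Lemma nr_ge0 z : 0 <= nr z.
Proof. by case: z => x y; rewrite /nr /= sqrtr_ge0. Qed.

Lemma nrM z w : nr (z * w) = nr z * nr w.
Proof. exact: ComplexField.Normc.normcM. Qed.

Lemma nr0 : nr 0 = 0.
Proof. exact: ComplexField.Normc.normc0. Qed.

Lemma nr1 : nr 1 = 1.
Proof. exact: ComplexField.Normc.normc1. Qed.

Lemma nrV z : nr z^-1 = (nr z)^-1.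
Proof. exact: ComplexField.Normc.normcV. Qed.

Lemma nrN z : nr (- z) = nr z.
Proof. exact: normcN. Qed.

Lemma nrD z w : nr (z + w) <= nr z + nr w.
Proof. exact: le_normcD. Qed.

Lemma nr_distC z w : nr (z - w) = nr (w - z).
Proof. by rewrite -nrN opprB. Qed.

Lemma nrB z w : nr (z - w) <= nr z + nr w.
Proof. by rewrite -[nr w]nrN nrD. Qed.

Lemma nr_triangle u z w : nr (z - w) <= nr (z - u) + nr (u - w).
Proof. by have := nrD (z - u) (u - w); rewrite addrA subrK. Qed.

Lemma nr_le_sub z w : nr z <= nr (z - w) + nr w.
Proof. by have := nrD (z - w) w; rewrite subrK. Qed.

Lemma nr_eq0 z : (nr z == 0) = (z == 0).
Proof.
apply/eqP/eqP => [/ComplexField.Normc.eq0_normc//|->]; exact: nr0.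
Qed.

Lemma nr_gt0 z : (0 < nr z) = (z != 0).
Proof. by rewrite lt_def nr_ge0 andbT nr_eq0. Qed.

Lemma nrX z n : nr (z ^+ n) = nr z ^+ n.
Proof. by elim: n => [|n IH]; rewrite ?expr0 ?nr1 // !exprS nrM IH. Qed.

Lemma nr_rc x : nr (rc x) = `|x|.
Proof. by rewrite /nr /rc /= expr0n /= addr0 sqrtr_sqr. Qed.

Lemma nr_iC : nr iC = 1.
Proof. by rewrite /nr /iC /= expr0n /= add0r expr1n sqrtr1. Qed.

Lemma iC2 : iC ^+ 2 = -1.
Proof. by rewrite /iC; apply/eqP; rewrite eq_complex /= ; apply/andP; split; apply/eqP; ring. Qed.

Lemma rcD x y : rc (x + y) = rc x + rc y.
Proof. exact: rmorphD. Qed.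
Lemma rcB x y : rc (x - y) = rc x - rc y.
Proof. exact: rmorphB. Qed.
Lemma rc0 : rc 0 = 0.
Proof. exact: rmorph0. Qed.
Lemma rc1 : rc 1 = 1.
Proof. exact: rmorph1. Qed.
Lemma rc_eq0 x : (rc x == 0) = (x == 0).
Proof. by rewrite -nr_eq0 nr_rc normr_eq0. Qed.

Lemma ReD z w : ReC (z + w) = ReC z + ReC w.
Proof. by case: z w => a b [c d]. Qed.
Lemma ImD z w : ImC (z + w) = ImC z + ImC w.
Proof. by case: z w => a b [c d]. Qed.
Lemma ReN z : ReC (- z) = - ReC z.
Proof. by case: z. Qed.
Lemma ImN z : ImC (- z) = - ImC z.
Proof. by case: z. Qed.
Lemma ReB z w : ReC (z - w) = ReC z - ReC w.
Proof. by rewrite ReD ReN. Qed.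
Lemma ImB z w : ImC (z - w) = ImC z - ImC w.
Proof. by rewrite ImD ImN. Qed.

Lemma mkCE x y : mkC x y = rc x + iC * rc y.
Proof. by apply/eqP; rewrite eq_complex /=; apply/andP; split; apply/eqP; ring. Qed.

Lemma mkC_ReIm z : mkC (ReC z) (ImC z) = z.
Proof. by case: z. Qed.

Lemma mkCB x y x' y' : mkC x y - mkC x' y' = mkC (x - x') (y - y').
Proof. by []. Qed.

Lemma Re_le_nr z : `|ReC z| <= nr z.
Proof.
case: z => x y; rewrite /nr /ReC /= -sqrtr_sqr ler_sqrt ?lerDl ?sqr_ge0 //.
by rewrite addr_ge0 ?sqr_ge0.
Qed.

Lemma Im_le_nr z : `|ImC z| <= nr z.
Proof.
case: z => x y; rewrite /nr /ImC /= -sqrtr_sqr ler_sqrt ?lerDr ?sqr_ge0 //.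
by rewrite addr_ge0 ?sqr_ge0.
Qed.

Lemma nr_le_ReIm z : nr z <= `|ReC z| + `|ImC z|.
Proof.
rewrite -{1}(mkC_ReIm z) mkCE (le_trans (nrD _ _))// nrM nr_iC mul1r.
by rewrite !nr_rc.
Qed.

Lemma ltr_nr z (e : R) : (`|z| < rc e) = (nr z < e).
Proof. by rewrite norm_nr ltcR. Qed.

Lemma nr_small z : (forall e, 0 < e -> nr z <= e) -> z = 0.
Proof.
move=> H; apply/eqP; rewrite -nr_eq0; apply/eqP/le_anti; rewrite nr_ge0 andbT.
by apply/ler_addgt0Pr => e e0; rewrite add0r; exact: H.
Qed.

(** * Neighbourhoods, complex differentiability and continuity with real radii *)

Lemma nbhsCP z (S : set (CC R)) :
  nbhs z S <-> exists2 e : R, 0 < e & forall w, nr (w - z) < e -> S w.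
Proof.
split.
  move=> /nbhs_ballP[e /= e0 H].
  (* A positive element of [CC R] is real, so it is its own real part. *)
  have er : e = rc (ReC e).
    have : (e : R[i]) \is Num.real by apply: gtr0_real.
    by move=> /RRe_real.
  exists (ReC e); first by move: e0; rewrite er; rewrite -[0]rc0 ltcR.
  move=> w wz; apply: H; rewrite -ball_normE /= er ltr_nr.
  by rewrite nr_distC.
move=> [e e0 H]; apply/nbhs_ballP; exists (rc e) => /=.
  by rewrite -rc0 ltcR.
by move=> w; rewrite -ball_normE /= ltr_nr nr_distC => /H.
Qed.

(** Division-free form of differentiability: the case [w = z] needs no exclusion, and the derivative
    [l] is explicit, so derivation rules compose as plain estimates. *)
Definition cdiff (f : CC R -> CC R) z l := forall e : R, 0 < e ->
  exists2 d : R, 0 < d & forall w, nr (w - z) < d ->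
    nr (f w - f z - l * (w - z)) <= e * nr (w - z).

Lemma derivable_cdiff f z : derivable f z 1 -> cdiff f z (derive1 f z).
Proof.
move=> df e e0.
have : (fun h => h^-1 *: (f (h + z) - f z)) @ 0^' --> derive1 f z.
  move: df; rewrite /derivable => /cvg_ex[l Hl].
  suff HH : (fun h => h^-1 *: (f (h + z) - f z)) @ 0^' --> l.
    by rewrite /derive1 (cvg_lim _ HH).
  have <- // : (fun h : CC R => h^-1 *: ((f \o shift z) (h *: (1 : CC R)) - f z))
           = (fun h => h^-1 *: (f (h + z) - f z)).
  by apply/funext => h /=; rewrite [h *: 1]mulr1.
move=> H; have /H : nbhs (derive1 f z) [set w | nr (w - derive1 f z) <= e].
  by apply/nbhsCP; exists e => // w /ltW.
rewrite /= nbhs_filterE /dnbhs /within /= => /nbhsCP[d d0 Hd].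
exists d => // w wz.
have [->|wz0] := eqVneq w z; first by rewrite !subrr mulr0 subrr nr0 mulr0.
have wz1 : w - z != 0 by rewrite subr_eq0.
have := Hd (w - z); rewrite /= subr0 subrK => /(_ wz wz1) /= H1.
have -> : f w - f z - derive1 f z * (w - z) =
    ((w - z)^-1 * (f w - f z) - derive1 f z) * (w - z).
  by field.
by rewrite nrM ler_wpM2r ?nr_ge0.
Qed.

Lemma cdiff_cvg f z l : cdiff f z l ->
  (fun h => h^-1 *: (f (h + z) - f z)) @ 0^' --> l.
Proof.
move=> H S /nbhsCP[e e0 HS].
have [d d0 Hd] := H _ (divr_gt0 e0 (ltr0Sn _ 1)).
rewrite /= nbhs_filterE /dnbhs /within /=; apply/nbhsCP; exists d => //.
move=> h; rewrite subr0 => hd h0; apply: HS.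
have := Hd (h + z); rewrite addrK => /(_ hd).
have -> : f (h + z) - f z - l * h = (h^-1 * (f (h + z) - f z) - l) * h by field.
rewrite nrM ler_pM2r ?nr_gt0// => /le_lt_trans; apply.
by rewrite ltr_pdivrMr// ltr_pMr// ltr1n.
Qed.

Lemma cdiff_derivable f z l : cdiff f z l -> derivable f z 1.
Proof.
move=> /cdiff_cvg H; apply/cvg_ex; exists l.
have -> // : (fun h : CC R => h^-1 *: ((f \o shift z) (h *: (1 : CC R)) - f z))
           = (fun h => h^-1 *: (f (h + z) - f z)).
by apply/funext => h /=; rewrite [h *: 1]mulr1.
Qed.

Lemma cdiff_derive1 f z l : cdiff f z l -> derive1 f z = l.
Proof. by move=> /cdiff_cvg H; rewrite /derive1 (cvg_lim _ H). Qed.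

Definition cdiffable f z := exists l, cdiff f z l.

Definition ccont (f : CC R -> CC R) z := forall e : R, 0 < e ->
  exists2 d : R, 0 < d & forall w, nr (w - z) < d -> nr (f w - f z) < e.

Lemma ccontP f z : ccont f z <-> {for z, continuous f}.
Proof.
split=> [H S /nbhsCP[e e0 HS]|H e e0].
  by have [d d0 Hd] := H _ e0; apply/nbhsCP; exists d => // w /Hd/HS.
have /H/nbhsCP[d d0 Hd] : nbhs (f z) [set w | nr (w - f z) < e].
  by apply/nbhsCP; exists e.
by exists d.
Qed.

Lemma cdiff_lip f z l : cdiff f z l ->
  exists2 d : R, 0 < d & forall w, nr (w - z) < d ->
    nr (f w - f z) <= (nr l + 1) * nr (w - z).
Proof.
move=> H; have [d d0 Hd] := H _ ltr01; exists d => // w /Hd.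
have := nr_le_sub (f w - f z) (l * (w - z)).
rewrite nrM mulrDl; lra.
Qed.

Lemma cdiff_ccont f z l : cdiff f z l -> ccont f z.
Proof.
move=> /cdiff_lip[d d0 H] e e0.
have L0 : 0 < nr l + 1 by have := nr_ge0 l; lra.
exists (Num.min d (e / (nr l + 1))); first by rewrite lt_min d0 divr_gt0.
move=> w; rewrite lt_min => /andP[wd we]; apply: (le_lt_trans (H _ wd)).
by move: we; rewrite ltr_pdivlMr // mulrC.
Qed.

Lemma cdiff_uniq f z l l' : cdiff f z l -> cdiff f z l' -> l = l'.
Proof. by move=> /cdiff_derive1 <- /cdiff_derive1. Qed.

Lemma cdiff_local f g z l (d : R) : 0 < d ->
  (forall w, nr (w - z) < d -> f w = g w) -> cdiff f z l -> cdiff g z l.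
Proof.
move=> d0 fg H e e0; have [d' d'0 H'] := H _ e0.
exists (Num.min d d'); first by rewrite lt_min d0.
move=> w; rewrite lt_min => /andP[wd wd'].
by rewrite -!fg ?subrr ?nr0//; exact: H'.
Qed.

Lemma cdiff_cst c z : cdiff (fun=> c) z 0.
Proof.
move=> e e0; exists 1 => // w _; rewrite subrr mul0r subr0 nr0.
by rewrite mulr_ge0 ?nr_ge0 ?ltW.
Qed.

Lemma cdiff_id z : cdiff id z 1.
Proof.
move=> e e0; exists 1 => // w _; rewrite mul1r subrr nr0.
by rewrite mulr_ge0 ?nr_ge0 ?ltW.
Qed.

Lemma cdiffD f g z l k : cdiff f z l -> cdiff g z k ->
  cdiff (fun w => f w + g w) z (l + k).
Proof.
move=> Hf Hg e e0; have e20 : 0 < e / 2 by rewrite divr_gt0.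
have [d d0 Hd] := Hf _ e20; have [d' d'0 Hd'] := Hg _ e20.
exists (Num.min d d'); first by rewrite lt_min d0.
move=> w; rewrite lt_min => /andP[/Hd wd /Hd' wd'].
have -> : f w + g w - (f z + g z) - (l + k) * (w - z) =
  (f w - f z - l * (w - z)) + (g w - g z - k * (w - z)) by ring.
have := nrD (f w - f z - l * (w - z)) (g w - g z - k * (w - z)); lra.
Qed.

Lemma cdiff_comp f g z l k : cdiff f z l -> cdiff g (f z) k ->
  cdiff (fun w => g (f w)) z (k * l).
Proof.
move=> Hf Hg e e0.
have [df df0 Lf] := cdiff_lip Hf.
(* [L] is a Lipschitz constant of [f] at [z]; the added 1 keeps [L] and [K] positive even when a
   derivative vanishes. *)
set L := nr l + 1; have L0 : 0 < L by rewrite /L; have := nr_ge0 l; lra.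
set K := nr k + 1; have K0 : 0 < K by rewrite /K; have := nr_ge0 k; lra.
have e1 : 0 < e / (2 * L) by rewrite divr_gt0// mulr_gt0.
have e2 : 0 < e / (2 * K) by rewrite divr_gt0// mulr_gt0.
have [d1 d10 H1] := Hg _ e1; have [d2 d20 H2] := Hf _ e2.
have [d3 d30 H3] := cdiff_ccont Hf d10.
exists (Num.min df (Num.min d2 d3)); first by rewrite !lt_min df0 d20.
move=> w; rewrite !lt_min => /and3P[/Lf w1 /H2 w2 /H3/H1 w3].
have -> : g (f w) - g (f z) - k * l * (w - z) =
  (g (f w) - g (f z) - k * (f w - f z)) + k * (f w - f z - l * (w - z)) by ring.
apply: (le_trans (nrD _ _)); rewrite nrM.
have A1 : nr (g (f w) - g (f z) - k * (f w - f z)) <= e / 2 * nr (w - z).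
  apply: (le_trans w3); apply: (@le_trans _ _ (e / (2 * L) * (L * nr (w - z)))).
    by rewrite ler_pM2l.
  rewrite le_eqVlt; apply/orP; left; apply/eqP; field; lra.
have A2 : nr k * nr (f w - f z - l * (w - z)) <= e / 2 * nr (w - z).
  apply: (@le_trans _ _ (K * (e / (2 * K) * nr (w - z)))).
    by apply: ler_pM; rewrite ?nr_ge0 // /K lerDl ler01.
  rewrite le_eqVlt; apply/orP; left; apply/eqP; field; lra.
lra.
Qed.

Lemma cdiff_sqr z : cdiff (fun w => w ^+ 2) z (2 * z).
Proof.
move=> e e0; exists e => // w we.
have -> : w ^+ 2 - z ^+ 2 - 2 * z * (w - z) = (w - z) * (w - z) by ring.
by rewrite nrM ler_wpM2r ?nr_ge0// ltW.
Qed.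

Lemma cdiffZ c f z l : cdiff f z l -> cdiff (fun w => c * f w) z (c * l).
Proof.
move=> Hf; apply: (cdiff_comp Hf) => e e0; exists 1 => // w _.
rewrite -mulrBr subrr nr0.
by rewrite mulr_ge0 ?nr_ge0 ?ltW.
Qed.

Lemma cdiffN f z l : cdiff f z l -> cdiff (fun w => - f w) z (- l).
Proof.
move=> /(@cdiffZ (-1)); rewrite mulN1r.
by congr cdiff; apply/funext => w; rewrite mulN1r.
Qed.

Lemma cdiffB f g z l k : cdiff f z l -> cdiff g z k ->
  cdiff (fun w => f w - g w) z (l - k).
Proof. by move=> Hf /cdiffN; exact: cdiffD. Qed.

(* Polarization reduces products to squares: [f g = ((f + g)^2 - f^2 - g^2) / 2]. *)
Lemma cdiffM f g z l k : cdiff f z l -> cdiff g z k ->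
  cdiff (fun w => f w * g w) z (l * g z + f z * k).
Proof.
move=> Hf Hg.
have Hfg := cdiff_comp (cdiffD Hf Hg) (@cdiff_sqr _).
have Hff := cdiff_comp Hf (@cdiff_sqr _).
have Hgg := cdiff_comp Hg (@cdiff_sqr _).
have := cdiffZ (2^-1) (cdiffB (cdiffB Hfg Hff) Hgg).
congr cdiff; last by field.
by apply/funext => w; field.
Qed.

Lemma cdiff_inv z : z != 0 -> cdiff (fun w => w^-1) z (- (z ^- 2)).
Proof.
move=> z0 e e0; have nz0 : 0 < nr z by rewrite nr_gt0.
(* The first bound gives [nr w >= nr z / 2]; with it, the second makes the error factor
   [(w - z) / (w * z ^+ 2)] at most [e]. *)
exists (Num.min (nr z / 2) (e * (nr z ^+ 3 / 2))).
  by rewrite lt_min divr_gt0// mulr_gt0 // divr_gt0// exprn_gt0.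
move=> w; rewrite lt_min => /andP[w1 w2].
have nw : nr z / 2 <= nr w.
  have := nr_le_sub z w; rewrite nr_distC; lra.
have nw0 : 0 < nr w by apply: lt_le_trans nw; rewrite divr_gt0.
have w0 : w != 0 by rewrite -nr_gt0.
have -> : w^-1 - z^-1 - - z ^- 2 * (w - z) = (w - z) / (w * z ^+ 2) * (w - z).
  by field; rewrite w0 z0.
rewrite nrM ler_wpM2r ?nr_ge0// nrM nrV nrM nrX ler_pdivrMr; last first.
  by rewrite mulr_gt0 ?exprn_gt0.
apply: (le_trans (ltW w2)); rewrite ler_pM2l//.
apply: (@le_trans _ _ (nr z / 2 * nr z ^+ 2)); first by rewrite le_eqVlt; apply/orP; left; apply/eqP; field.
by rewrite ler_wpM2r// exprn_ge0// ltW.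
Qed.

Lemma cdiffV f z l : f z != 0 -> cdiff f z l ->
  cdiff (fun w => (f w)^-1) z (- (f z ^- 2) * l).
Proof. by move=> fz0 Hf; apply: (cdiff_comp Hf); exact: cdiff_inv. Qed.

Lemma cdiffX f n z l : cdiff f z l -> cdiffable (fun w => f w ^+ n) z.
Proof.
move=> Hf; elim: n => [|n [k IH]].
  by exists 0; apply: (@cdiff_local (fun=> 1) _ _ _ 1) => // *; exact: cdiff_cst.
exists (l * f z ^+ n + f z * k).
apply: (@cdiff_local (fun w => f w * f w ^+ n) _ _ _ 1) => //; last exact: cdiffM.
by move=> w _; rewrite exprS.
Qed.

End modulus.

(** * Paths of a real variable: Cousin induction, mean value inequality, primitives *)

Section real_variable.
Context {R : realType}.
Implicit Types (P p : R -> CC R).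

Lemma dyadic_small (L d : R) : 0 < d -> exists n, L / 2 ^+ n < d.
Proof.
move=> d0; exists (Num.truncn (`|L| / d)).+1; set n := Num.truncn _.
have Hn : `|L| / d < n.+1%:R by rewrite truncnS_gt.
rewrite ltr_pdivrMr ?exprn_gt0// (le_lt_trans (ler_norm L))//.
move: Hn; rewrite ltr_pdivrMr// => /lt_trans; apply.
rewrite mulrC ltr_pM2l// -natrX ltr_nat; exact: ltn_expl.
Qed.

(** Every left endpoint lies below every right endpoint, so the supremum of the left endpoints
    belongs to all the intervals. *)
Lemma nested_dyadic (u : nat -> R) (L : R) : 0 <= L ->
  (forall n, u n <= u n.+1 /\ u n.+1 + L / 2 ^+ n.+1 <= u n + L / 2 ^+ n) ->
  exists s, forall n, u n <= s <= u n + L / 2 ^+ n.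
Proof.
move=> L0 H.
have up n k : u n <= u (n + k)%N.
  by elim: k => [|k IH]; rewrite ?addn0// addnS (le_trans IH)// (H _).1.
have dn n k : u (n + k)%N + L / 2 ^+ (n + k) <= u n + L / 2 ^+ n.
  by elim: k => [|k IH]; rewrite ?addn0// addnS (le_trans (H _).2).
have ge n : 0 <= L / 2 ^+ n by rewrite divr_ge0// exprn_ge0.
have mn m n : u m <= u n + L / 2 ^+ n.
  have [mn|nm] := leqP m n.
    have := up m (n - m)%N; rewrite subnKC// => Hu.
    by rewrite (le_trans Hu)// lerDl.
  by have := dn n (m - n)%N; rewrite subnKC 1?ltnW//; apply: le_trans; rewrite lerDl.
have hs : has_sup (range u).
  by split; [exists (u 0%N), 0%N | exists (u 0%N + L / 2 ^+ 0) => _ [m _ <-]].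
exists (sup (range u)) => n; apply/andP; split.
  by apply: sup_upper_bound => //; exists n.
by apply: ge_sup; [exists (u 0%N), 0%N | move=> _ [m _ <-]].
Qed.

(* Cousin's lemma, by quartering; with [H = 0] it covers intervals. *)
Lemma rectangle_induction (Q : R -> R -> R -> R -> Prop) (a b W H : R) :
  0 <= W -> 0 <= H ->
  (forall x y w h, a <= x -> x + w <= a + W -> b <= y -> y + h <= b + H ->
     0 <= w -> 0 <= h ->
     Q x y (w / 2) (h / 2) -> Q (x + w / 2) y (w / 2) (h / 2) ->
     Q x (y + h / 2) (w / 2) (h / 2) ->
     Q (x + w / 2) (y + h / 2) (w / 2) (h / 2) -> Q x y w h) ->
  (forall x0 y0, a <= x0 <= a + W -> b <= y0 <= b + H ->
     exists2 d, 0 < d & forall x y w h,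
       a <= x -> x + w <= a + W -> b <= y -> y + h <= b + H ->
       0 <= w < d -> 0 <= h < d -> x <= x0 <= x + w -> y <= y0 <= y + h ->
       Q x y w h) ->
  Q a b W H.
Proof.
move=> W0 H0 Hadd Hloc; apply: contrapT => nQ.
pose ww n := W / 2 ^+ n; pose hh n := H / 2 ^+ n.
have wwS n : ww n.+1 = ww n / 2 by rewrite /ww exprS invfM mulrA mulrAC.
have hhS n : hh n.+1 = hh n / 2 by rewrite /hh exprS invfM mulrA mulrAC.
have ww0 n : 0 <= ww n by rewrite divr_ge0// exprn_ge0.
have hh0 n : 0 <= hh n by rewrite divr_ge0// exprn_ge0.
pose q n (s : R * R) := `[< Q s.1 s.2 (ww n) (hh n) >].
(* Moves to the first quarter on which [Q] fails; if the first three satisfy [Q], the fourth must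
   fail because [Q] is additive. *)
pose nxt n (s : R * R) : R * R :=
  let x := s.1 in let y := s.2 in let w := ww n.+1 in let h := hh n.+1 in
  if ~~ q n.+1 (x, y) then (x, y) else
  if ~~ q n.+1 (x + w, y) then (x + w, y) else
  if ~~ q n.+1 (x, y + h) then (x, y + h) else (x + w, y + h).
pose st := fix st n := if n is k.+1 then nxt k (st k) else (a, b).
have st1 n : ((st n.+1).1 = (st n).1 \/ (st n.+1).1 = (st n).1 + ww n.+1) /\
  ((st n.+1).2 = (st n).2 \/ (st n.+1).2 = (st n).2 + hh n.+1).
  rewrite /= /nxt; case: ifP => _ /=; first by split; left.
  case: ifP => _ /=; first by split; [right|left].
  by case: ifP => _ /=; split; [left|right|right|right].
have [xs Hx] : exists s, forall n, (st n).1 <= s <= (st n).1 + W / 2 ^+ n.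
  apply: nested_dyadic => // n; rewrite -/(ww _) -/(ww _) wwS.
  by have := ww0 n; have [[->|->] _] := st1 n; rewrite ?wwS; split; lra.
have [ys Hy] : exists s, forall n, (st n).2 <= s <= (st n).2 + H / 2 ^+ n.
  apply: nested_dyadic => // n; rewrite -/(hh _) -/(hh _) hhS.
  by have := hh0 n; have [_ [->|->]] := st1 n; rewrite ?hhS; split; lra.
have inr n : [/\ a <= (st n).1, (st n).1 + ww n <= a + W,
                 b <= (st n).2 & (st n).2 + hh n <= b + H].
  elim: n => [|n [? ? ? ?]]; first by rewrite /= /ww /hh !expr0 !divr1; split.
  have := ww0 n; have := hh0 n.
  have [[->|->] [->|->]] := st1 n; rewrite wwS hhS; split; lra.
have nq n : ~ Q (st n).1 (st n).2 (ww n) (hh n).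
  elim: n => [|n IH]; first by rewrite /ww /hh !expr0 !divr1.
  move=> Hq; apply: IH; have [? ? ? ?] := inr n.
  move: Hq; rewrite /= /nxt; set x := (st n).1; set y := (st n).2.
  case: ifPn => [/asboolPn//|/negPn/asboolP q1].
  case: ifPn => [/asboolPn//|/negPn/asboolP q2].
  case: ifPn => [/asboolPn//|/negPn/asboolP q3] q4.
  by apply: Hadd; rewrite -?wwS -?hhS.
have [||d d0 Hd] := Hloc xs ys.
- by have := Hx 0%N; rewrite /= expr0 divr1.
- by have := Hy 0%N; rewrite /= expr0 divr1.
have [n Hn] := dyadic_small (W + H) d0.
have wn : ww n < d.
  by apply: le_lt_trans Hn; rewrite /ww ler_wpM2r ?invr_ge0 ?exprn_ge0// lerDl.
have hn : hh n < d.
  by apply: le_lt_trans Hn; rewrite /hh ler_wpM2r ?invr_ge0 ?exprn_ge0// lerDr.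
have [? ? ? ?] := inr n.
by apply: (nq n); apply: Hd; rewrite ?ww0 ?hh0.
Qed.

Definition rdiff P (a b t : R) (l : CC R) := forall e : R, 0 < e ->
  exists2 d : R, 0 < d & forall s, a <= s <= b -> `|s - t| < d ->
    nr (P s - P t - rc (s - t) * l) <= e * `|s - t|.

(** Complex values admit no mean value equality. The inequality with slack [e] is additive over
    subintervals and holds on short intervals around each point by differentiability, so Cousin's
    lemma applies. *)
Lemma rdiff_mvi P p (a b M : R) : a <= b ->
  (forall t, a <= t <= b -> rdiff P a b t (p t)) ->
  (forall t, a <= t <= b -> nr (p t) <= M) ->
  nr (P b - P a) <= M * (b - a).
Proof.
move=> ab HP HM.
suff H (e : R) : 0 < e -> nr (P b - P a) <= (M + e) * (b - a).
  have [->|ba] := eqVneq a b; first by rewrite !subrr nr0 mulr0.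
  have ba0 : 0 < b - a by rewrite subr_gt0 lt_neqAle ba.
  rewrite -ler_pdivrMr//; apply/ler_addgt0Pr => e e0.
  by rewrite ler_pdivrMr// H.
move=> e0.
pose Q (x y w h : R) := nr (P (x + w) - P x) <= (M + e) * w.
(* A rectangle of height 0 stands for the interval. *)
suff : Q a 0 (b - a) 0 by rewrite /Q subrKC.
apply: (@rectangle_induction Q); rewrite ?subr_ge0// /Q ?subrKC.
- move=> x y w h _ _ _ _ _ _ q1 q2 _ _.
  have := nr_triangle (P (x + w / 2)) (P (x + w)) (P x).
  have wE : x + w / 2 + w / 2 = x + w by field.
  move: q2; rewrite wE => q2; lra.
- move=> x0 y0 x0ab _; have [d d0 Hd] := HP _ x0ab _ e0.
  exists d => // x y w h ax xwb _ _ /andP[w0 wd] _ /andP[xx0 x0x] _.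
  have Mx := HM _ x0ab.
  have H1 : nr (P (x + w) - P x0) <= (M + e) * (x + w - x0).
    have := Hd (x + w); rewrite ger0_norm; last lra.
    have /[swap]/[apply] : a <= x + w <= b by lra.
    have /[swap]/[apply] : x + w - x0 < d by lra.
    have := nr_le_sub (P (x + w) - P x0) (rc (x + w - x0) * p x0).
    rewrite nrM nr_rc ger0_norm; last lra.
    have : (x + w - x0) * nr (p x0) <= (x + w - x0) * M.
      by apply: ler_wpM2l => //; lra.
    lra.
  have H2 : nr (P x0 - P x) <= (M + e) * (x0 - x).
    have := Hd x; rewrite ler0_norm; last lra.
    have /[swap]/[apply] : a <= x <= b by lra.
    have /[swap]/[apply] : - (x - x0) < d by lra.
    have := nr_le_sub (P x - P x0) (rc (x - x0) * p x0).
    rewrite nrM nr_rc ler0_norm; last lra.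
    rewrite (nr_distC (P x) (P x0)).
    have : (x0 - x) * nr (p x0) <= (x0 - x) * M.
      by apply: ler_wpM2l => //; lra.
    lra.
  have := nr_triangle (P x0) (P (x + w)) (P x); lra.
Qed.

Definition rcont P (a b t : R) := forall e : R, 0 < e ->
  exists2 d : R, 0 < d & forall s, a <= s <= b -> `|s - t| < d ->
    nr (P s - P t) < e.

Lemma real_primitive (u : R -> R) (a b : R) : a <= b -> continuous u ->
  exists F : R -> R, forall t, a <= t <= b -> forall e, 0 < e ->
    exists2 d, 0 < d & forall s, `|s - t| < d ->
      `|F s - F t - (s - t) * u t| <= e * `|s - t|.
Proof.
move=> ab cu.
(* Integrating on [[a - 1, b + 1]] makes every point of [[a, b]], endpoints included, an interior
   point for the fundamental theorem of calculus. *)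
pose F (x : R) := (\int[lebesgue_measure]_(t in `[(a - 1)%R, x]) u t)%R.
exists F => t /andP[at_ tb] e e0.
have tb1 : t < b + 1 by lra.
have at1 : a - 1 < t by lra.
have iu : lebesgue_measure.-integrable `[a - 1, b + 1] (EFin \o u).
  apply: continuous_compact_integrable; first exact: segment_compact.
  exact: continuous_subspaceT.
have [dF FE] := continuous_FTC1_closed tb1 iu at1 (cu t).
have : (fun h => h^-1 *: (F (h + t) - F t)) @ 0^' --> u t.
  move: dF; rewrite -FE /derivable => /cvg_ex[l Hl].
  have H : (fun h => h^-1 *: (F (h + t) - F t)) @ 0^' --> l.
    have <- // : (fun h : R => h^-1 *: ((F \o shift t) (h *: (1 : R)) - F t))
           = (fun h => h^-1 *: (F (h + t) - F t)).
    by apply/funext => h /=; rewrite [h *: 1]mulr1.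
  by rewrite /derive1 (cvg_lim _ H).
move=> H; have /H : nbhs (u t) [set w | `|w - u t| <= e].
  apply/nbhs_ballP; exists e => //= w; rewrite /ball /= distrC; exact: ltW.
rewrite /= nbhs_filterE /dnbhs /within /= => /nbhs_ballP[d /= d0 Hd].
exists d => // s sd.
have [->|st] := eqVneq s t; first by rewrite !subrr mul0r subrr normr0 mulr0.
have st0 : s - t != 0 by rewrite subr_eq0.
have := Hd (s - t); rewrite /ball /= sub0r normrN subrK => /(_ sd st0).
have -> : F s - F t - (s - t) * u t = ((s - t)^-1 * (F s - F t) - u t) * (s - t).
  by field.
by rewrite normrM => ?; rewrite ler_wpM2r.
Qed.

(** The projection onto [[a, b]]; composing with it extends a path continuous on [[a, b]] to a path
    continuous on the whole line. *)
Definition clamp (a b t : R) := Num.max a (Num.min b t).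

Lemma clamp_in a b t : a <= b -> a <= clamp a b t <= b.
Proof. by move=> ab; rewrite /clamp le_max lexx /= ge_max ab ge_min lexx. Qed.

Lemma clamp_id a b t : a <= t <= b -> clamp a b t = t.
Proof.
by move=> /andP[at_ tb]; rewrite /clamp (min_idPr tb) (max_idPr at_).
Qed.

Lemma clamp_lip a b s t : a <= b -> `|clamp a b s - clamp a b t| <= `|s - t|.
Proof.
move=> ab; rewrite /clamp.
case: (lerP b s) => bs; case: (lerP b t) => bt;
  rewrite ?(max_idPr ab) ?subrr ?normr0//.
- by case: (lerP a t) => ?; rewrite !ger0_norm; lra.
- by case: (lerP a s) => ?; rewrite !ler0_norm; lra.
- case: (lerP a s) => ?; case: (lerP a t) => ? //.
  + by rewrite !ger0_norm; lra.
  + by rewrite !ler0_norm; lra.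
  + by rewrite subrr normr0.
Qed.

(** Real and imaginary parts are extended by [clamp] and integrated separately. *)
Lemma rprimitive p (a b : R) : a <= b -> (forall t, a <= t <= b -> rcont p a b t) ->
  exists P, forall t, a <= t <= b -> rdiff P a b t (p t).
Proof.
move=> ab cp.
have cc (f : CC R -> R) : (forall z w, `|f z - f w| <= nr (z - w)) ->
    continuous (fun t => f (p (clamp a b t))).
  move=> lf t S /nbhs_ballP[e /= e0 HS].
  have [d d0 Hd] := cp _ (clamp_in t ab) _ e0.
  apply/nbhs_ballP; exists d => //= s; rewrite /ball /= distrC => st.
  apply: HS; rewrite /ball /= distrC; apply: le_lt_trans (lf _ _) _.
  apply: Hd; first exact: clamp_in.
  by apply: le_lt_trans st; exact: clamp_lip.
have [|F HF] := real_primitive ab (cc (@ReC R) _).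
  by move=> z w; rewrite -ReB; exact: Re_le_nr.
have [|G HG] := real_primitive ab (cc (@ImC R) _).
  by move=> z w; rewrite -ImB; exact: Im_le_nr.
exists (fun t => mkC (F t) (G t)) => t tab e e0.
have e20 : 0 < e / 2 by rewrite divr_gt0.
have [d d0 Hd] := HF _ tab _ e20; have [d' d'0 Hd'] := HG _ tab _ e20.
exists (Num.min d d'); first by rewrite lt_min d0.
move=> s sab; rewrite lt_min => /andP[/Hd + /Hd'] {Hd Hd'}.
rewrite !clamp_id// => H1 H2.
apply: (le_trans (nr_le_ReIm _)); rewrite !ReB !ImB.
have -> : ReC (rc (s - t) * p t) = (s - t) * ReC (p t).
  by case: (p t) => x y; rewrite /ReC /=; ring.
have -> : ImC (rc (s - t) * p t) = (s - t) * ImC (p t).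
  by case: (p t) => x y; rewrite /ImC /=; ring.
rewrite /ReC /ImC /= in H1 H2 *; lra.
Qed.

End real_variable.

(** * Goursat's theorem and primitives on rectangles *)

Section goursat.
Context {R : realType}.
Implicit Types (f F P p q : CC R -> CC R).

Lemma rdiff_sub (P : R -> CC R) (a b a' b' t : R) l : a <= a' -> b' <= b ->
  rdiff P a b t l -> rdiff P a' b' t l.
Proof.
move=> aa bb H e /H[d d0 Hd]; exists d => // s /andP[as_ sb]; apply: Hd.
by rewrite (le_trans aa)// (le_trans sb).
Qed.

Lemma rdiffB (P Q : R -> CC R) (a b t : R) l k :
  rdiff P a b t l -> rdiff Q a b t k ->
  rdiff (fun s => P s - Q s) a b t (l - k).
Proof.
move=> HP HQ e e0; have e20 : 0 < e / 2 by rewrite divr_gt0.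
have [d d0 Hd] := HP _ e20; have [d' d'0 Hd'] := HQ _ e20.
exists (Num.min d d'); first by rewrite lt_min d0.
move=> s sab; rewrite lt_min => /andP[/(Hd _ sab) H1 /(Hd' _ sab) H2].
have -> : P s - Q s - (P t - Q t) - rc (s - t) * (l - k) =
  (P s - P t - rc (s - t) * l) - (Q s - Q t - rc (s - t) * k) by ring.
have := nrB (P s - P t - rc (s - t) * l) (Q s - Q t - rc (s - t) * k); lra.
Qed.

Lemma rdiff_iC (P : R -> CC R) (a b t : R) l :
  rdiff P a b t l -> rdiff (fun s => iC * P s) a b t (iC * l).
Proof.
move=> H e /H[d d0 Hd]; exists d => // s sab st; rewrite -(mul1r e).
have -> : iC * P s - iC * P t - rc (s - t) * (iC * l) =
  iC * (P s - P t - rc (s - t) * l) by ring.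
by rewrite nrM nr_iC !mul1r Hd.
Qed.

Lemma rdiff_linear (a b t : R) l : rdiff (fun s => rc s * l) a b t l.
Proof.
move=> e e0; exists 1 => // s _ _; rewrite rcB mulrBl subrr nr0.
by rewrite mulr_ge0// ltW.
Qed.

Lemma cdiff_rdiff_horizontal f (a b t y : R) l :
  cdiff f (mkC t y) l -> rdiff (fun s => f (mkC s y)) a b t l.
Proof.
move=> H e /H[d d0 Hd]; exists d => // s _ st.
have E : mkC s y - mkC t y = rc (s - t) by rewrite mkCB subrr.
by have := Hd (mkC s y); rewrite E nr_rc [l * _]mulrC; apply.
Qed.

Lemma cdiff_rdiff_vertical f (a b t x : R) l :
  cdiff f (mkC x t) l -> rdiff (fun s => f (mkC x s)) a b t (iC * l).
Proof.
move=> H e /H[d d0 Hd]; exists d => // s _ st.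
have E : mkC x s - mkC x t = iC * rc (s - t).
  by rewrite mkCB subrr mkCE rc0 add0r.
have := Hd (mkC x s); rewrite E nrM nr_iC mul1r nr_rc.
have -> : l * (iC * rc (s - t)) = rc (s - t) * (iC * l) by ring.
exact.
Qed.

(** Covers both orders of [x] and [x'], as required when a primitive is differentiated at a point
    approached from either side. *)
Lemma rdiff_mvi_dist (P p : R -> CC R) (a b x x' M : R) :
  a <= x <= b -> a <= x' <= b ->
  (forall t, a <= t <= b -> rdiff P a b t (p t)) ->
  (forall t, a <= t <= b -> `|t - x| <= `|x' - x| -> nr (p t) <= M) ->
  nr (P x' - P x) <= M * `|x' - x|.
Proof.
move=> /andP[ax xb] /andP[ax' xb'] HP HM.
have [xx'|x'x] := leP x x'.
  rewrite ger0_norm ?subr_ge0//; apply: (@rdiff_mvi _ P p) => // t /andP[xt tx'].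
    by apply: (@rdiff_sub _ a b) => //; apply: HP; lra.
  by apply: HM; first lra; rewrite !ger0_norm; lra.
rewrite ltr0_norm ?subr_lt0// opprB nr_distC.
apply: (@rdiff_mvi _ P p) => [|t /andP[xt tx']|t /andP[xt tx']]; first exact: ltW.
  by apply: (@rdiff_sub _ a b) => //; apply: HP; lra.
by apply: HM; first lra; rewrite !ler0_norm; lra.
Qed.

Section rectangle.
Variables (f : CC R -> CC R) (a a' b b' : R).
Let inr z := a <= ReC z <= a' /\ b <= ImC z <= b'.
Hypothesis df : forall z, inr z -> cdiffable f z.
(** Antiderivatives of [f] along each horizontal and each vertical line; line integrals become
    differences of their values. *)
Variables H V : R -> R -> CC R.
Hypothesis HH : forall y, b <= y <= b' ->
  forall t, a <= t <= a' -> rdiff (H y) a a' t (f (mkC t y)).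
Hypothesis HV : forall x, a <= x <= a' ->
  forall t, b <= t <= b' -> rdiff (V x) b b' t (f (mkC x t)).

(* The integral of [f] along the boundary of [x1, x2] x [y1, y2]. *)
Let cyc x1 x2 y1 y2 := (H y1 x2 - H y1 x1) + iC * (V x2 y2 - V x2 y1)
  - (H y2 x2 - H y2 x1) - iC * (V x1 y2 - V x1 y1).

(** Goursat's local estimate: the affine approximation of [f] at [z0] has a primitive, so it
    contributes nothing around the boundary, and the remainder is at most [e * s] on each of the
    four sides. *)
Let cyc_small (z0 : CC R) (e : R) : inr z0 -> 0 < e ->
  exists2 d, 0 < d & forall x1 x2 y1 y2,
    a <= x1 -> x2 <= a' -> b <= y1 -> y2 <= b' ->
    x1 <= ReC z0 <= x2 -> y1 <= ImC z0 <= y2 -> (x2 - x1) + (y2 - y1) < d ->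
    nr (cyc x1 x2 y1 y2) <= 2 * e * ((x2 - x1) + (y2 - y1)) ^+ 2.
Proof.
move=> z0in e0; have [l Hl] := df z0in; have [d d0 Hd] := Hl _ e0.
exists d => // x1 x2 y1 y2 ax1 xa2 by1 yb2 x12 y12 small.
set s := x2 - x1 + (y2 - y1) in small *.
(* [p] is a primitive of the affine approximation [q]; its values at the four corners cancel in
   [cyc]. *)
pose p z := f z0 * z + l * (2^-1 * (z - z0) ^+ 2).
pose q z := f z0 + l * (z - z0).
have dp z : cdiff p z (q z).
  have := cdiffD (cdiffZ (f z0) (@cdiff_id _ z))
    (cdiffZ l (cdiffZ 2^-1 (cdiff_comp (cdiffB (@cdiff_id _ z) (@cdiff_cst _ z0 z))
    (@cdiff_sqr _ (z - z0))))).
  by congr cdiff; rewrite /q; field.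
have small_q x y : x1 <= x <= x2 -> y1 <= y <= y2 ->
    nr (f (mkC x y) - q (mkC x y)) <= e * s.
  move=> xx yy; have nz : nr (mkC x y - z0) <= s.
    apply: (le_trans (nr_le_ReIm _)); rewrite ReB ImB /= /s lerD//.
      by rewrite /ReC /= ler_norml; move: x12; rewrite /ReC /=; lra.
    by rewrite /ImC /= ler_norml; move: y12; rewrite /ImC /=; lra.
  have := Hd (mkC x y) (le_lt_trans nz small).
  rewrite /q opprD addrA => /le_trans; apply; rewrite ler_pM2l//.
have x1x2 : x1 <= x2 by lra. have y1y2 : y1 <= y2 by lra.
have EH y : y1 <= y <= y2 ->
    nr ((H y x2 - p (mkC x2 y)) - (H y x1 - p (mkC x1 y))) <= e * s * (x2 - x1).
  move=> yy.
  apply: (@rdiff_mvi _ (fun t => H y t - p (mkC t y))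
    (fun t => f (mkC t y) - q (mkC t y))) => // t tt; last exact: small_q.
  apply: (@rdiff_sub _ a a') => //; apply: rdiffB; first by apply: HH; lra.
  exact: cdiff_rdiff_horizontal.
have EV x : x1 <= x <= x2 ->
    nr ((iC * V x y2 - p (mkC x y2)) - (iC * V x y1 - p (mkC x y1)))
      <= e * s * (y2 - y1).
  move=> xx.
  apply: (@rdiff_mvi _ (fun t => iC * V x t - p (mkC x t))
    (fun t => iC * f (mkC x t) - iC * q (mkC x t))) => // t tt; last first.
    by rewrite -mulrBr nrM nr_iC mul1r; exact: small_q.
  apply: (@rdiff_sub _ b b') => //; apply: rdiffB.
    by apply: rdiff_iC; apply: HV; lra.
  exact: cdiff_rdiff_vertical.
have h1 := EH _ (introT andP (conj (lexx y1) y1y2)).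
have h2 := EH _ (introT andP (conj y1y2 (lexx y2))).
have h3 := EV _ (introT andP (conj (lexx x1) x1x2)).
have h4 := EV _ (introT andP (conj x1x2 (lexx x2))).
have -> : cyc x1 x2 y1 y2 =
  ((H y1 x2 - p (mkC x2 y1)) - (H y1 x1 - p (mkC x1 y1))) +
  ((iC * V x2 y2 - p (mkC x2 y2)) - (iC * V x2 y1 - p (mkC x2 y1))) -
  ((H y2 x2 - p (mkC x2 y2)) - (H y2 x1 - p (mkC x1 y2))) -
  ((iC * V x1 y2 - p (mkC x1 y2)) - (iC * V x1 y1 - p (mkC x1 y1))).
  by rewrite /cyc; ring.
have -> : 2 * e * s ^+ 2 = e * s * (x2 - x1) + e * s * (y2 - y1) +
  e * s * (x2 - x1) + e * s * (y2 - y1) by rewrite /s; ring.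
apply: (le_trans (nrB _ _)); apply: lerD => //.
apply: (le_trans (nrB _ _)); apply: lerD => //.
by apply: (le_trans (nrD _ _)); apply: lerD.
Qed.

(** The bound [2 * e * (w + h) ^+ 2] is the sum of the bounds of the four quarters, so the local
    estimate propagates to the whole rectangle by Cousin's lemma. *)
Let cyc0 x1 x2 y1 y2 : a <= x1 -> x1 <= x2 -> x2 <= a' ->
  b <= y1 -> y1 <= y2 -> y2 <= b' -> cyc x1 x2 y1 y2 = 0.
Proof.
move=> ax1 x12 xa2 by1 y12 yb2; apply: nr_small => e0' e0'0.
pose W := x2 - x1; pose K := y2 - y1.
have W0 : 0 <= W by rewrite subr_ge0.
have K0 : 0 <= K by rewrite subr_ge0.
(* Chosen so that [2 * e * (W + K) ^+ 2 <= e0']; the added 1 covers a degenerate rectangle. *)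
pose e := e0' / (2 * ((W + K) ^+ 2 + 1)).
have e0 : 0 < e.
  by rewrite divr_gt0// mulr_gt0// ltr_wpDl ?sqr_ge0.
pose Q x y w h := nr (cyc x (x + w) y (y + h)) <= 2 * e * (w + h) ^+ 2.
suff : Q x1 y1 W K.
  rewrite /Q /W /K !subrKC -/W -/K => /le_trans; apply.
  rewrite /e; set s := (W + K) ^+ 2.
  have s0 : 0 <= s by rewrite sqr_ge0.
  have -> : 2 * (e0' / (2 * (s + 1))) * s = e0' * (s / (s + 1)).
    by field; lra.
  rewrite ger_pMr// ler_pdivrMr; lra.
apply: (@rectangle_induction _ Q) => //; rewrite /W /K !subrKC.
- move=> x y w h _ _ _ _ w0 h0; rewrite /Q.
  rewrite -!addrA; have wE (c : R) : c / 2 + c / 2 = c by field.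
  rewrite !wE => q1 q2 q3 q4.
  have -> : cyc x (x + w) y (y + h) =
    cyc x (x + w / 2) y (y + h / 2) + cyc (x + w / 2) (x + w) y (y + h / 2) +
    cyc x (x + w / 2) (y + h / 2) (y + h) +
    cyc (x + w / 2) (x + w) (y + h / 2) (y + h).
    by rewrite /cyc; ring.
  have -> : 2 * e * (w + h) ^+ 2 = 2 * e * (w / 2 + h / 2) ^+ 2 +
   2 * e * (w / 2 + h / 2) ^+ 2 + 2 * e * (w / 2 + h / 2) ^+ 2 +
   2 * e * (w / 2 + h / 2) ^+ 2 by field.
  apply: (le_trans (nrD _ _)); apply: lerD => //.
  apply: (le_trans (nrD _ _)); apply: lerD => //.
  by apply: (le_trans (nrD _ _)); apply: lerD.
- move=> x0 y0 xx yy; have zin : inr (mkC x0 y0).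
    by split; rewrite /ReC /ImC /=; lra.
  have [d d0 Hd] := cyc_small zin e0.
  exists (d / 2); first by rewrite divr_gt0.
  move=> x y w h ? ? ? ? /andP[w0 wd] /andP[h0 hd] ? ?; rewrite /Q.
  have := Hd x (x + w) y (y + h); rewrite ![_ + _ - _]addrAC !subrr !add0r.
  by apply; rewrite /ReC /ImC /=; lra.
Qed.

Lemma rectangle_primitive : exists F,
  forall z, a < ReC z < a' -> b < ImC z < b' -> cdiff F z (f z).
Proof.
(* The integral of [f] from the lower left corner, first along the bottom side and then
   vertically. *)
pose F z := (H b (ReC z) - H b a) + iC * (V (ReC z) (ImC z) - V (ReC z) b).
exists F => z zx zy e e0.
have zin : inr z by split; lra.
have [l Hl] := df zin; have e20 : 0 < e / 2 by rewrite divr_gt0.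
have [d d0 Hd] := cdiff_ccont Hl e20.
set x := ReC z in zx; set y := ImC z in zy.
pose r := Num.min (Num.min (x - a) (a' - x)) (Num.min (y - b) (b' - y)).
have r0 : 0 < r by rewrite !lt_min; lra.
exists (Num.min (d / 2) r); first by rewrite lt_min divr_gt0.
move=> w; set x' := ReC w; set y' := ImC w.
rewrite !lt_min => /andP[wd /andP[/andP[w1 w2] /andP[w3 w4]]].
have nx : `|x' - x| <= nr (w - z) by rewrite -ReB Re_le_nr.
have ny : `|y' - y| <= nr (w - z) by rewrite -ImB Im_le_nr.
have x'in : a <= x' <= a' by move: nx; rewrite ler_norml; lra.
have y'in : b <= y' <= b' by move: ny; rewrite ler_norml; lra.
have xin : a <= x <= a' by lra.
have yin : b <= y <= b' by lra.
(* This moves the horizontal part of the increment of [F] from height [b] up to height [y], so that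
   only values of [f] near [z] matter. *)
have cyc00 : cyc x x' b y = 0.
  have [xx'|x'x] := leP x x'; first by apply: cyc0; lra.
  suff : cyc x' x b y = 0 by rewrite /cyc => E; rewrite -[RHS]oppr0 -[in RHS]E; ring.
  by apply: cyc0; lra.
have -> : F w - F z - f z * (w - z) =
    ((H y x' - rc x' * f z) - (H y x - rc x * f z)) +
    iC * ((V x' y' - rc y' * f z) - (V x' y - rc y * f z)).
  have -> : w - z = rc x' - rc x + iC * (rc y' - rc y).
    by rewrite -[in LHS](mkC_ReIm w) -(mkC_ReIm z) !mkCE /=; ring.
  rewrite /F -/x -/y -/x' -/y'; apply/eqP; rewrite -subr_eq0 -cyc00 /cyc; apply/eqP; ring.
have A1 : nr ((H y x' - rc x' * f z) - (H y x - rc x * f z)) <= e / 2 * `|x' - x|.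
  apply: (@rdiff_mvi_dist (fun t => H y t - rc t * f z)
    (fun t => f (mkC t y) - f z) a a') => // t tt.
    by apply: rdiffB; [exact: HH|exact: rdiff_linear].
  move=> tx; apply/ltW/Hd; apply: (le_lt_trans (nr_le_ReIm _)).
  by rewrite ReB ImB /= -/x -/y /ReC /ImC /= subrr normr0 addr0; lra.
have A2 : nr ((V x' y' - rc y' * f z) - (V x' y - rc y * f z)) <= e / 2 * `|y' - y|.
  apply: (@rdiff_mvi_dist (fun t => V x' t - rc t * f z)
    (fun t => f (mkC x' t) - f z) b b') => // t tt.
    by apply: rdiffB; [exact: HV|exact: rdiff_linear].
  move=> tx; apply/ltW/Hd; apply: (le_lt_trans (nr_le_ReIm _)).
  by rewrite ReB ImB /= -/x -/y; have := nr_ge0 (w - z); rewrite /ReC /ImC /= in nx tx *; lra.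
apply: (le_trans (nrD _ _)); rewrite nrM nr_iC mul1r.
have : e / 2 * `|x' - x| <= e / 2 * nr (w - z) by rewrite ler_wpM2l// ltW.
have : e / 2 * `|y' - y| <= e / 2 * nr (w - z) by rewrite ler_wpM2l// ltW.
lra.
Qed.

End rectangle.

Lemma holomorphic_primitive f (a a' b b' : R) : a <= a' -> b <= b' ->
  (forall z, a <= ReC z <= a' -> b <= ImC z <= b' -> cdiffable f z) ->
  exists F, forall z, a < ReC z < a' -> b < ImC z < b' -> cdiff F z (f z).
Proof.
move=> aa' bb' df.
have /choice[H HH] : forall y, exists P : R -> CC R, b <= y <= b' ->
    forall t, a <= t <= a' -> rdiff P a a' t (f (mkC t y)).
  move=> y.
  have [yin|] := boolP (b <= y <= b'); last by exists (fun=> 0).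
  have [|P HP] := @rprimitive _ (fun t => f (mkC t y)) a a' aa'; last by exists P.
  move=> t tin e e0; have [||l /cdiff_ccont/(_ _ e0)[d d0 Hd]] := df (mkC t y) => //.
  exists d => // s _ st; apply: Hd.
  by rewrite mkCB subrr (_ : mkC _ _ = rc (s - t)) ?nr_rc.
have /choice[V HV] : forall x, exists P : R -> CC R, a <= x <= a' ->
    forall t, b <= t <= b' -> rdiff P b b' t (f (mkC x t)).
  move=> x.
  have [xin|] := boolP (a <= x <= a'); last by exists (fun=> 0).
  have [|P HP] := @rprimitive _ (fun t => f (mkC x t)) b b' bb'; last by exists P.
  move=> t tin e e0; have [||l /cdiff_ccont/(_ _ e0)[d d0 Hd]] := df (mkC x t) => //.
  exists d => // s _ st; apply: Hd.
  by rewrite mkCB subrr mkCE rc0 add0r nrM nr_iC mul1r nr_rc.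
by apply: (@rectangle_primitive f a a' b b' _ H V HH HV) => z [? ?]; exact: df.
Qed.

End goursat.

(** * Compact discs and annuli, and the maximum principle *)

Section maximum_principle.
Context {R : realType}.
Implicit Types (f F G : CC R -> CC R) (x z : CC R).

Lemma nr_sqr z : nr z ^+ 2 = ReC z ^+ 2 + ImC z ^+ 2.
Proof.
by case: z => u v; rewrite /nr /ReC /ImC /= sqr_sqrtr// addr_ge0 ?sqr_ge0.
Qed.

Lemma continuous_nrP (u : CC R -> R) z :
  (forall e, 0 < e -> exists2 d, 0 < d &
     forall w, nr (w - z) < d -> `|u w - u z| < e) -> {for z, continuous u}.
Proof.
move=> H S /nbhs_ballP[e /= e0 HS]; have [d d0 Hd] := H _ e0.
by apply/nbhsCP; exists d => // w /Hd; rewrite distrC => ?; apply: HS.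
Qed.

Lemma compact_square (r : R) :
  compact [set z : CC R | `|ReC z| <= r /\ `|ImC z| <= r].
Proof.
have [r0|r0] := leP 0 r; last first.
  rewrite (_ : [set _ | _] = set0); first exact: compact0.
  by rewrite -subset0 => z [/= zr _]; have := normr_ge0 (ReC z); lra.
pose m (p : R * R) : CC R := mkC p.1 p.2.
have -> : [set z : CC R | `|ReC z| <= r /\ `|ImC z| <= r] =
    m @` (`[- r, r] `*` `[- r, r]).
  apply/seteqP; split => [z [/= zx zy]|z [[u v] [/= + +] <-]].
    exists (ReC z, ImC z); last by rewrite /m /= mkC_ReIm.
    by rewrite /= !in_itv /= -!ler_norml.
  by rewrite !in_itv /= -!ler_norml.
apply: continuous_compact; last first.
  by apply: compact_setX; exact: segment_compact.
apply: continuous_subspaceT => p S /nbhsCP[e e0 HS].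
have e20 : 0 < e / 2 by rewrite divr_gt0.
apply/nbhs_ballP; exists (e / 2) => //= q [/= q1 q2]; apply: HS.
rewrite /ball /= in q1 q2.
apply: (le_lt_trans (nr_le_ReIm _)); rewrite ReB ImB /m /ReC /ImC /=.
by rewrite distrC [X in _ + X]distrC; lra.
Qed.

Lemma compact_bounded_closed (S : set (CC R)) (r : R) : closed S ->
  (forall z, S z -> nr z <= r) -> compact S.
Proof.
move=> cS Sr; apply: (subclosed_compact cS (compact_square (r := r))) => z /Sr zr.
split=> /=; [exact: le_trans (Re_le_nr z) zr|exact: le_trans (Im_le_nr z) zr].
Qed.

Lemma continuous_nr_sub x : continuous (fun z : CC R => nr (z - x)).
Proof.
move=> z; apply: continuous_nrP => e e0; exists e => // w wz.
apply: le_lt_trans wz; rewrite ler_norml; apply/andP; split.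
  have := nr_triangle w z x; rewrite (nr_distC z w); lra.
have := nr_triangle z w x; lra.
Qed.

Lemma compact_annulus x (r1 r2 : R) :
  compact [set z : CC R | r1 <= nr (z - x) <= r2].
Proof.
apply: (@compact_bounded_closed _ (r2 + nr x)); last first.
  by move=> z /= /andP[_ zr]; have := nr_le_sub z x; lra.
rewrite (_ : [set _ | _] = (fun z : CC R => nr (z - x)) @^-1` `[r1, r2]).
  apply: preimage_closed; last exact: itv_closed.
  by move=> z _; exact: continuous_nr_sub.
by apply/seteqP; split => z; rewrite /= in_itv.
Qed.

Lemma cdiff_rdiff_segment F z k (t : R) l :
  cdiff F (z + rc t * k) l ->
  rdiff (fun s => F (z + rc s * k)) 0 1 t (l * k).
Proof.
move=> H e e0.
have E (s : R) : z + rc s * k - (z + rc t * k) = rc (s - t) * k.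
  by rewrite rcB; ring.
have [k0|k0] := eqVneq k 0.
  exists 1 => // s _ _; rewrite k0 !mulr0 !subrr nr0.
  by rewrite mulr_ge0// ltW.
have nk : 0 < nr k by rewrite nr_gt0.
have [d d0 Hd] := H _ (divr_gt0 e0 nk).
exists (d / nr k); first by rewrite divr_gt0.
move=> s _; rewrite ltr_pdivlMr// => st.
have := Hd (z + rc s * k); rewrite E nrM nr_rc => /(_ st).
have -> : e / nr k * (`|s - t| * nr k) = e * `|s - t| by field; lra.
by have -> : l * (rc (s - t) * k) = rc (s - t) * (l * k) by ring.
Qed.

Lemma cdiff_mvi F F1 z k (M : R) :
  (forall w, nr (w - z) <= nr k -> cdiff F w (F1 w)) ->
  (forall w, nr (w - z) <= nr k -> nr (F1 w) <= M) ->
  nr (F (z + k) - F z) <= M * nr k.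
Proof.
move=> HF HM.
have seg (t : R) : 0 <= t <= 1 -> nr (z + rc t * k - z) <= nr k.
  move=> /andP[t0 t1]; rewrite [z + _]addrC addrK nrM nr_rc ger0_norm//.
  by rewrite ler_piMl ?nr_ge0.
have := @rdiff_mvi _ (fun t => F (z + rc t * k)) (fun t => F1 (z + rc t * k) * k)
  0 1 (M * nr k) ler01.
rewrite rc0 rc1 mul1r mul0r addr0 subr0 mulr1; apply.
  by move=> t /seg/HF; exact: cdiff_rdiff_segment.
by move=> t /seg/HM ?; rewrite nrM ler_wpM2r ?nr_ge0.
Qed.

(** The mean value inequality is applied to [G] minus its quadratic Taylor polynomial, whose
    derivative is the first-order error of [G1], at most [e * nr k]. *)
Lemma cdiff_taylor2 G G1 z (r : R) l : 0 < r ->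
  (forall w, nr (w - z) < r -> cdiff G w (G1 w)) -> cdiff G1 z l ->
  forall e, 0 < e -> exists2 d, 0 < d & forall k, nr k < d ->
    nr (G (z + k) - G z - G1 z * k - l / 2 * k ^+ 2) <= e * nr k ^+ 2.
Proof.
move=> r0 HG HG1 e e0; have [d d0 Hd] := HG1 _ e0.
exists (Num.min d r); first by rewrite lt_min d0.
move=> k; rewrite lt_min => /andP[kd kr].
pose Phi w := G w - (G1 z * w + l * (2^-1 * (w - z) ^+ 2)).
have dPhi w : nr (w - z) <= nr k -> cdiff Phi w (G1 w - G1 z - l * (w - z)).
  move=> wz; have := cdiffB (HG _ (le_lt_trans wz kr))
    (cdiffD (cdiffZ (G1 z) (@cdiff_id _ w)) (cdiffZ l (cdiffZ 2^-1
    (cdiff_comp (cdiffB (@cdiff_id _ w) (@cdiff_cst _ z w))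
    (@cdiff_sqr _ (w - z)))))).
  by congr cdiff; field.
have := cdiff_mvi dPhi (M := e * nr k).
rewrite (_ : Phi (z + k) - Phi z = G (z + k) - G z - G1 z * k - l / 2 * k ^+ 2).
  rewrite -[e * nr k * nr k]mulrA -expr2; apply=> w wk.
  by apply: (le_trans (Hd _ (le_lt_trans wk kd))); rewrite ler_pM2l.
by rewrite /Phi; field.
Qed.

(** If [M] were exceeded, [ReC (G z) + e * nr (z - x) ^+ 2] would have an interior maximum for small
    [e]. Over four steps [k] in perpendicular directions the terms in [k] and in [k ^+ 2] cancel,
    while the added square contributes a positive amount. *)
Lemma maximum_principle_Re G G1 x (rho r1 r2 M : R) :
  (forall z, nr (z - x) < rho -> cdiff G z (G1 z)) ->
  (forall z, nr (z - x) < rho -> cdiffable G1 z) ->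
  0 < r1 -> r1 < r2 -> r2 < rho ->
  (forall z, r1 <= nr (z - x) <= r2 -> ReC (G z) <= M) ->
  forall z, nr (z - x) <= r2 -> ReC (G z) <= M.
Proof.
move=> HG HG1 r10 r12 r2rho HM zs zsr; rewrite leNgt; apply/negP => MG.
have r20 : 0 < r2 by lra.
(* The perturbation adds at most half of the excess over [M], so the maximum cannot fall in the
   annulus. *)
pose e := (ReC (G zs) - M) / (2 * r2 ^+ 2).
have e0 : 0 < e by rewrite divr_gt0 ?subr_gt0// mulr_gt0// exprn_gt0.
pose u z : R := ReC (G z) + e * nr (z - x) ^+ 2.
pose K := [set z : CC R | 0 <= nr (z - x) <= r2].
have KE z : K z = (nr (z - x) <= r2) by rewrite /K /= nr_ge0.
have cu : {within K, continuous u}.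
  apply: continuous_in_subspaceT => z; rewrite inE KE => zr.
  have c1 : {for z, continuous (fun w => ReC (G w))}.
    apply: continuous_nrP => e' e'0.
    have [d d0 Hd] := cdiff_ccont (HG _ (le_lt_trans zr r2rho)) e'0.
    by exists d => // w /Hd; apply: le_lt_trans; rewrite -ReB Re_le_nr.
  have c2 := @continuous_nr_sub x z.
  have c3 := continuousM (@cst_continuous _ _ e z) (continuousM c2 c2).
  exact: (continuousD c1 c3).
have K0 : K !=set0 by exists zs; rewrite KE.
have [z0] := compact_EVT_max K0 (@compact_annulus x 0 r2) cu.
rewrite inE KE => z0r Hz0.
have Hmax z : nr (z - x) <= r2 -> u z <= u z0.
  by move=> zr; apply: Hz0; rewrite inE KE.
have z0in : nr (z0 - x) < r1.
  rewrite ltNge; apply/negP => r1z0.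
  have := HM z0; rewrite r1z0 z0r => /(_ isT) Mz0.
  have := Hmax _ zsr; rewrite /u.
  have : e * nr (z0 - x) ^+ 2 <= e * r2 ^+ 2.
    by rewrite ler_pM2l// lerXn2r// ?nnegrE ?nr_ge0// ltW.
  have : e * r2 ^+ 2 = (ReC (G zs) - M) / 2 by rewrite /e; field; lra.
  have : 0 <= e * nr (zs - x) ^+ 2 by rewrite mulr_ge0 ?exprn_ge0 ?nr_ge0// ltW.
  lra.
have z0rho : nr (z0 - x) < rho by lra.
have [l Hl] := HG1 _ z0rho.
have e20 : 0 < e / 2 by rewrite divr_gt0.
have [||d d0 Hd] := @cdiff_taylor2 G G1 z0 (rho - r1) l _ _ Hl _ e20.
- lra.
- by move=> w wz; apply: HG; have := nr_triangle z0 w x; lra.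
(* Short enough for the Taylor estimate and for [z0 + k] to stay in the disc of radius [r2]. *)
pose t := Num.min (d / 2) (r2 - r1).
have t0 : 0 < t by rewrite lt_min divr_gt0// subr_gt0.
have td : t < d by rewrite gt_min; apply/orP; left; lra.
have tr : t <= r2 - r1 by rewrite ge_min lexx orbT.
have T k : nr k = t ->
    ReC (G z0) + ReC (G1 z0 * k) + ReC (l / 2 * k ^+ 2) - e / 2 * t ^+ 2
      + e * nr (z0 + k - x) ^+ 2 <= u z0.
  move=> kt; have -> : ReC (G z0) + ReC (G1 z0 * k) + ReC (l / 2 * k ^+ 2) =
    ReC (G (z0 + k)) - ReC (G (z0 + k) - G z0 - G1 z0 * k - l / 2 * k ^+ 2).
    by rewrite !ReB; ring.
  have := Hd k; rewrite kt => /(_ td).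
  have := Re_le_nr (G (z0 + k) - G z0 - G1 z0 * k - l / 2 * k ^+ 2).
  rewrite ler_norml => /andP[+ _].
  have : u (z0 + k) <= u z0.
    apply: Hmax; have := nr_triangle z0 (z0 + k) x.
    by rewrite (_ : z0 + k - z0 = k); [lra|ring].
  rewrite /u; lra.
have nt : nr (rc t) = t by rewrite nr_rc gtr0_norm.
have := T (rc t) nt.
have := T (- rc t); rewrite nrN => /(_ nt).
have nit : nr (iC * rc t) = t by rewrite nrM nr_iC mul1r.
have := T _ nit.
have := T (- (iC * rc t)); rewrite nrN => /(_ nit).
rewrite /u !nr_sqr !sqrrN exprMn iC2 mulN1r !mulrN !ReN.
rewrite !(ReD, ImD, ReN, ImN).
have -> : ReC (rc t) = t by [].
have -> : ImC (rc t) = 0 by [].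
have -> : ReC (iC * rc t) = 0 by rewrite /ReC /=; ring.
have -> : ImC (iC * rc t) = t by rewrite /ImC /=; ring.
set A := ReC (G1 z0 * rc t); set B := ReC (G1 z0 * (iC * rc t)).
set D := ReC (l / 2 * rc t ^+ 2).
set X := ReC z0 - ReC x; set Y := ImC z0 - ImC x.
(* Adding the four inequalities leaves [4 * e * t ^+ 2 <= 4 * (e / 2) * t ^+ 2], which is absurd. *)
move=> h1 h2 h3 h4.
have t2 : 0 < e * t ^+ 2 by rewrite mulr_gt0// exprn_gt0.
move: h1 h2 h3 h4 t2; rewrite /X /Y; clearbody t e A B D.
move: (ReC (G z0)) (ReC z0) (ReC x) (ImC z0) (ImC x) => g' a a' b b'.
clear; lra.
Qed.

(** A primitive [F] of [f] has a differentiable derivative, so the real-part version applies to its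
    difference quotients. They are bounded by [M] on a narrower annulus and approximate [f] at
    [z0]. *)
Lemma maximum_principle f x (rho r1 r2 M : R) :
  (forall z, nr (z - x) < rho -> cdiffable f z) ->
  0 < r1 -> r1 < r2 -> 3 * r2 <= rho ->
  (forall z, r1 <= nr (z - x) <= r2 -> nr (f z) <= M) ->
  forall z, nr (z - x) <= r2 -> nr (f z) <= M.
Proof.
move=> Hf r10 r12 r2rho HM z0 z0r.
(* The square of half-side [s] lies in the disc of radius [rho], and it contains the disc of radius
   [r2] because [3 * r2 <= rho]. *)
pose s := rho / 3.
have [|||F HF] := @holomorphic_primitive _ f (ReC x - s) (ReC x + s)
  (ImC x - s) (ImC x + s).
- by rewrite /s; lra.
- by rewrite /s; lra.
- move=> z zx zy; apply: Hf; apply: (le_lt_trans (nr_le_ReIm _)).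
  have A1 : `|ReC (z - x)| <= s by rewrite ler_norml ReB; lra.
  have A2 : `|ImC (z - x)| <= s by rewrite ler_norml ImB; lra.
  by rewrite /s in A1 A2; lra.
have {}HF z : nr (z - x) < s -> cdiff F z (f z).
  move=> zs; apply: HF.
    by have := Re_le_nr (z - x); rewrite ler_norml ReB; lra.
  by have := Im_le_nr (z - x); rewrite ler_norml ImB; lra.
have M0 : 0 <= M.
  apply: le_trans (nr_ge0 _) (HM (x + rc r2) _).
  by rewrite [x + _]addrC addrK nr_rc gtr0_norm; lra.
pose q := (r2 - r1) / 3.
have q0 : 0 < q by rewrite divr_gt0// subr_gt0.
have [z0r1|z0r1] := leP r1 (nr (z0 - x)); first by apply: HM; rewrite z0r1.
have [fz0|fz0] := eqVneq (f z0) 0; first by rewrite fz0 nr0.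
(* A rotation making [f z0] real and nonnegative, so that its real part is its modulus. *)
pose c := (f z0)^-1 * rc (nr (f z0)).
have nfz : 0 < nr (f z0) by rewrite nr_gt0.
have nc : nr c = 1.
  by rewrite /c nrM nrV nr_rc gtr0_norm// mulVf// gt_eqF.
have cf : c * f z0 = rc (nr (f z0)) by rewrite /c mulrAC mulVf// mul1r.
apply/ler_addgt0Pr => e e0.
have [|d d0 Hd] := HF z0 _ _ e0; first by rewrite /s; lra.
pose t := Num.min (d / 2) (q / 2).
have t0 : 0 < t by rewrite lt_min; apply/andP; split; lra.
have td : t < d by rewrite gt_min; apply/orP; left; lra.
have tq : t < q by rewrite gt_min; apply/orP; right; lra.
have nt : nr (rc t) = t by rewrite nr_rc gtr0_norm.
have rct0 : rc t != 0 by rewrite rc_eq0 gt_eqF.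
pose k := c / rc t.
have nk : nr k = t^-1 by rewrite /k nrM nrV nc nt mul1r.
have near_t z : nr (z + rc t - x) <= nr (z - x) + t.
  by have := nrD (z - x) (rc t); rewrite addrAC nt.
have near_t' z : nr (z - x) - t <= nr (z + rc t - x).
  have := nrB (z + rc t - x) (rc t).
  by rewrite nt (_ : z + rc t - x - rc t = z - x); [lra|ring].
(* Removing a width [q] on both sides of the annulus keeps each segment from [z] to [z + t] inside
   the original one, where [nr (f w) <= M]. *)
have key : ReC (k * (F (z0 + rc t) - F z0)) <= M.
  apply: (@maximum_principle_Re (fun z => k * (F (z + rc t) - F z))
    (fun z => k * (f (z + rc t) - f z)) x (s - t) (r1 + q) (r1 + 2 * q) M).
  - move=> z zs; apply: cdiffZ; apply: cdiffB; last by apply: HF; lra.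
    have H1 : nr (z + rc t - x) < s by have := near_t z; lra.
    have H2 : cdiff (fun w => w + rc t) z 1.
      by have := cdiffD (@cdiff_id _ z) (@cdiff_cst _ (rc t) z); rewrite addr0.
    by have := cdiff_comp H2 (HF _ H1); rewrite mulr1.
  - move=> z zs.
    have H1 : nr (z + rc t - x) < rho by have := near_t z; rewrite /s in zs; lra.
    have [l1 Hl1] := Hf _ H1.
    have [|l2 Hl2] := Hf z; first by rewrite /s in zs; lra.
    have H2 : cdiff (fun w => w + rc t) z 1.
      by have := cdiffD (@cdiff_id _ z) (@cdiff_cst _ (rc t) z); rewrite addr0.
    by eexists; apply: cdiffZ; apply: cdiffB Hl2; exact: (cdiff_comp H2 Hl1).
  - lra.
  - lra.
  - by rewrite /s /q in q0 tq *; lra.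
  - move=> z /andP[zr1 zr2].
    have H w : nr (w - z) <= nr (rc t) -> r1 <= nr (w - x) < r2.
      rewrite nt => wz; have := nr_triangle z w x; have := nr_triangle w z x.
      by rewrite (nr_distC z w) /q in tq zr1 zr2 *; lra.
    have := @cdiff_mvi F f z (rc t) M; rewrite nt => Hmvi.
    have : nr (F (z + rc t) - F z) <= M * t.
      apply: Hmvi => w; rewrite -{1}nt => /H wz; last by apply: HM; lra.
      by apply: HF; rewrite /s /q in tq *; lra.
    move=> HFt; apply: le_trans (ler_norm _) _; apply: le_trans (Re_le_nr _) _.
    by rewrite nrM nk mulrC ler_pdivrMr.
  - by lra.
have := Hd (z0 + rc t); rewrite (_ : z0 + rc t - z0 = rc t); last by ring.
rewrite nt => /(_ td) Ht.
have E : rc (nr (f z0)) = k * (F (z0 + rc t) - F z0) -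
    k * (F (z0 + rc t) - F z0 - f z0 * rc t).
  by rewrite -cf /k; field.
have -> : nr (f z0) = ReC (rc (nr (f z0))) by [].
rewrite E ReB lerD//; apply: le_trans (ler_norm _) _.
rewrite normrN; apply: le_trans (Re_le_nr _) _.
by rewrite nrM nk mulrC ler_pdivrMr.
Qed.

End maximum_principle.

(** * Removable points, the Cauchy estimate and univalent maps *)

Section univalent_maps.
Context {R : realType}.
Implicit Types (f F G : CC R -> CC R) (x z : CC R).

Lemma bernoulli_ineq (a : R) n : 0 <= a -> 1 + n%:R * a <= (1 + a) ^+ n.
Proof.
move=> a0; elim: n => [|n IH]; first by rewrite mul0r addr0 expr0.
rewrite exprS -natr1; have : (1 + a) * (1 + n%:R * a) <= (1 + a) * (1 + a) ^+ n.
  by rewrite ler_wpM2l// addr_ge0.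
have : 0 <= n%:R * (a * a) by rewrite !mulr_ge0.
lra.
Qed.

Lemma expr_unbounded (a c : R) : 1 < a -> exists n, c < a ^+ n.
Proof.
move=> a1; have a0 : 0 < a - 1 by rewrite subr_gt0.
exists (Num.truncn (c / (a - 1))).+1; set n := (Num.truncn _).+1.
have : c / (a - 1) < n%:R by rewrite truncnS_gt.
rewrite ltr_pdivrMr// => /lt_le_trans; apply.
by have := @bernoulli_ineq (a - 1) n (ltW a0); rewrite subrKC; lra.
Qed.

(** Replaces the extraction of n-th roots: if [M < a], the powers of [a / M] exceed [D / c]. *)
Lemma le_of_exprn_bound (a M c D : R) : 0 < M -> 0 < c ->
  (forall n, a ^+ n * c <= M ^+ n * D) -> a <= M.
Proof.
move=> M0 c0 H; rewrite leNgt; apply/negP => Ma.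
have aM : 1 < a / M by rewrite ltr_pdivlMr ?mul1r.
have [n] := expr_unbounded (D / c) aM; apply/negP; rewrite -leNgt.
by rewrite expr_div_n ler_pdivlMr// mulrAC ler_pdivrMr ?exprn_gt0// [X in _ <= X]mulrC.
Qed.

(* [(f z) ^+ n * (z - p)] is differentiable at [p] too; take n-th roots. *)
Lemma maximum_principle_removable f x p (rho r1 r2 M : R) :
  (forall z, nr (z - x) < rho -> z <> p -> cdiffable f z) -> ccont f p ->
  0 < r1 -> r1 < r2 -> 3 * r2 <= rho -> nr (p - x) < r2 ->
  (forall z, r1 <= nr (z - x) <= r2 -> nr (f z) <= M) ->
  forall z, nr (z - x) <= r2 -> nr (f z) <= M.
Proof.
move=> Hf cp r10 r12 r2rho pr2 HM.
have M0 : 0 <= M.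
  apply: le_trans (nr_ge0 _) (HM (x + rc r2) _).
  by rewrite [x + _]addrC addrK nr_rc gtr0_norm; lra.
(* The bound at [p] follows from nearby points by continuity. *)
suff np z : nr (z - x) <= r2 -> z <> p -> nr (f z) <= M.
  move=> z zr; have [->|/eqP] := eqVneq z p; last exact: np.
  apply/ler_addgt0Pr => e e0; have [d d0 Hd] := cp _ e0.
  pose t := Num.min (d / 2) (r2 - nr (p - x)).
  have t0 : 0 < t by rewrite lt_min divr_gt0// subr_gt0.
  have td : t < d by rewrite gt_min; apply/orP; left; lra.
  have tr : t <= r2 - nr (p - x) by rewrite ge_min lexx orbT.
  have nt : nr (rc t) = t by rewrite nr_rc gtr0_norm.
  have E : p + rc t - p = rc t by ring.
  have H1 := Hd (p + rc t); rewrite E nt in H1.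
  have H2 : nr (f (p + rc t)) <= M.
    apply: np; first by have := nr_triangle p (p + rc t) x; rewrite E nt; lra.
    move=> /(congr1 (fun w => w - p)); rewrite E subrr => /(congr1 nr).
    by rewrite nt nr0; lra.
  by have := nr_le_sub (f p) (f (p + rc t)); rewrite nr_distC; have := H1 td; lra.
move=> zr zp; have nzp : 0 < nr (z - p) by rewrite nr_gt0 subr_eq0; apply/eqP.
apply/ler_addgt0Pr => e e0.
(* The base is [M + e], since [M] may be 0; [2 * r2] bounds [nr (w - p)] on the annulus. *)
apply: (@le_of_exprn_bound _ _ (nr (z - p)) (2 * r2)) => // [|n]; first by lra.
rewrite -nrX -nrM; apply: (@maximum_principle _ (fun z => f z ^+ n * (z - p))
  x rho r1 r2) => // w wr; last first.
  rewrite nrM nrX; apply: ler_pM; rewrite ?exprn_ge0 ?nr_ge0//.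
    by rewrite lerXn2r ?nnegrE ?nr_ge0//; [lra|have := HM _ wr; lra].
  by have := nr_triangle x w p; rewrite (nr_distC x p); lra.
have [->|/eqP wp] := eqVneq w p; last first.
  have [l Hl] := Hf _ wr wp; have [k Hk] := cdiffX n Hl.
  by eexists; apply: cdiffM Hk (cdiffB (@cdiff_id _ w) (@cdiff_cst _ p w)).
(* The difference quotient of [f z ^+ n * (z - p)] at [p] is [f z ^+ n], so continuity of [f] at [p]
   yields this derivative. *)
exists (f p ^+ n) => e' e'0.
have cn : ccont (fun z => f z ^+ n) p.
  apply/ccontP; move/ccontP: cp => cp.
  elim: n {w wr} => [|n IH].
    rewrite (_ : (fun z => f z ^+ 0) = fun=> 1); first exact: cst_continuous.
    by apply/funext => w; rewrite expr0.
  rewrite (_ : (fun z => f z ^+ n.+1) = (fun z => f z * f z ^+ n)).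
    exact: (continuousM cp IH).
  by apply/funext => w; rewrite exprS.
have [d d0 Hd] := cn _ e'0; exists d => // w' /Hd w'd.
rewrite subrr mulr0 subr0 -mulrBl nrM ler_wpM2r ?nr_ge0//; exact: ltW.
Qed.

Definition slope f p l z := if z == p then l else (f z - f p) / (z - p).

Lemma slope_cdiffable f p l z : z <> p -> cdiffable f z ->
  cdiffable (slope f p l) z.
Proof.
move=> /eqP zp [k Hk]; have zp0 : z - p != 0 by rewrite subr_eq0.
have := cdiffM (cdiffB Hk (@cdiff_cst _ (f p) z))
  (cdiffV (f := fun w => w - p) zp0 (cdiffB (@cdiff_id _ z) (@cdiff_cst _ p z))).
move=> H; eexists; apply: cdiff_local H; first by rewrite -nr_gt0 in zp0; exact: zp0.
move=> w wz; rewrite /slope ifF//; apply/eqP => wp; move: wz.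
by rewrite wp nr_distC ltxx.
Qed.

Lemma slope_ccont f p l : cdiff f p l -> ccont (slope f p l) p.
Proof.
move=> H e e0; have e20 : 0 < e / 2 by rewrite divr_gt0.
have [d d0 Hd] := H _ e20; exists d => // w /Hd.
rewrite /slope eqxx; have [->|wp] := eqVneq w p; first by move=> _; rewrite subrr nr0.
have wp0 : w - p != 0 by rewrite subr_eq0.
have -> : f w - f p - l * (w - p) = ((f w - f p) / (w - p) - l) * (w - p) by field.
by rewrite nrM ler_pM2r ?nr_gt0//; lra.
Qed.

(** The derivative is the value at [x] of the slope function, which is at most [2 * M / (rho / 6)]
    on the annulus from [rho / 6] to [rho / 3]. *)
Lemma cauchy_estimate f x l (rho M : R) : 0 < rho ->
  (forall z, nr (z - x) < rho -> cdiffable f z) ->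
  (forall z, nr (z - x) < rho -> nr (f z) <= M) -> cdiff f x l ->
  nr l <= 12 * M / rho.
Proof.
move=> rho0 Hf HM Hl.
have -> : l = slope f x l x by rewrite /slope eqxx.
apply: (@maximum_principle_removable _ x x rho (rho / 6) (rho / 3)); try lra.
- by move=> z zr zx; apply: slope_cdiffable => //; exact: Hf.
- exact: slope_ccont.
- by rewrite subrr nr0; lra.
- move=> z zr; rewrite /slope ifF; last first.
    by apply/eqP => zx; move: zr; rewrite zx subrr nr0; lra.
  rewrite nrM nrV ler_pdivrMr; last lra.
  have xr : nr (x - x) < rho by rewrite subrr nr0.
  have zrho : nr (z - x) < rho by lra.
  have := nrB (f z) (f x); have := HM _ xr; have := HM _ zrho => M1 M2 M3.
  apply: le_trans M3 _; apply: (@le_trans _ _ (12 * M / rho * (rho / 6))).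
    by have -> : 12 * M / rho * (rho / 6) = 2 * M by [field; lra]; lra.
  by rewrite ler_wpM2l ?divr_ge0 ?mulr_ge0//; have := nr_ge0 (f x); lra.
- by rewrite subrr nr0; lra.
Qed.

(** [nr (f z - f x)] attains its minimum on the compact annulus, and injectivity at [x] makes that
    minimum positive. *)
Lemma injective_annulus_bound f x (rho r1 r2 : R) :
  (forall z, nr (z - x) < rho -> cdiffable f z) ->
  (forall z, nr (z - x) < rho -> f z = f x -> z = x) ->
  0 < r1 -> r1 <= r2 -> r2 < rho ->
  exists2 delta, 0 < delta &
    forall z, r1 <= nr (z - x) <= r2 -> delta <= nr (f z - f x).
Proof.
move=> Hf inj r10 r12 r2rho.
pose K := [set z : CC R | r1 <= nr (z - x) <= r2].
have KE z : K z = (r1 <= nr (z - x) <= r2) by [].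
have K0 : K !=set0.
  by exists (x + rc r1); rewrite KE [x + _]addrC addrK nr_rc gtr0_norm; lra.
have [|c] := compact_EVT_min K0 (@compact_annulus _ x r1 r2)
    (f := fun z => nr (f z - f x)).
  apply: continuous_in_subspaceT => z; rewrite inE KE => zr.
  have zr' : nr (z - x) < rho by lra.
  have [l /cdiff_ccont/ccontP cl] := Hf _ zr'.
  exact: continuous_comp cl (@continuous_nr_sub _ _ _).
rewrite inE KE => cr Hc; exists (nr (f c - f x)).
  rewrite nr_gt0 subr_eq0; apply/eqP => fcx.
  have cx : c = x by apply: inj => //; lra.
  by move: cr; rewrite cx subrr nr0; lra.
by move=> z zr; apply: Hc; rewrite inE KE.
Qed.

(** If [f] omitted a value [w] within [delta / 2] of [f x], then [1 / (f - w)] would be larger at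
    [x] than on the annulus, against the maximum principle. *)
Lemma univalent_open f x (rho : R) : 0 < rho ->
  (forall z, nr (z - x) < rho -> cdiffable f z) ->
  (forall z, nr (z - x) < rho -> f z = f x -> z = x) ->
  exists2 eta, 0 < eta &
    forall w, nr (w - f x) < eta -> exists2 z, nr (z - x) < rho & f z = w.
Proof.
move=> rho0 Hf inj.
have [| | |delta delta0 Hd] := @injective_annulus_bound f x rho (rho / 6) (rho / 3)
   Hf inj; try lra.
exists (delta / 2); first by rewrite divr_gt0.
move=> w wd; apply: contrapT => nz.
have {}nz z : nr (z - x) < rho -> f z - w != 0.
  by move=> zr; rewrite subr_eq0; apply/eqP => fz; apply: nz; exists z.
have dw : 0 < delta - nr (w - f x) by lra.
have : nr ((f x - w)^-1) <= (delta - nr (w - f x))^-1.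
  apply: (@maximum_principle _ (fun z => (f z - w)^-1) x rho (rho / 6) (rho / 3));
    try lra.
  - move=> z zr; have [l Hl] := Hf _ zr; eexists.
    exact: (@cdiffV _ (fun z => f z - w) z _ (nz _ zr) (cdiffB Hl (@cdiff_cst _ w z))).
  - move=> z zr; have zd := Hd _ zr.
    have E : delta - nr (w - f x) <= nr (f z - w).
      by have := nr_triangle w (f z) (f x); lra.
    by rewrite nrV lef_pV2 ?posrE//; lra.
  - by rewrite subrr nr0; lra.
have xw : 0 < nr (f x - w) by rewrite nr_gt0 nz// subrr nr0.
by rewrite nrV lef_pV2 ?posrE// nr_distC; rewrite nr_distC in wd *; lra.
Qed.

(* For [zeta] near [x] with [f' zeta <> 0] the quotient
   [(z - zeta) / (f z - f zeta)] is bounded by a constant that does not depend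
   on [zeta]; letting [zeta] tend to [x], the derivative at [x] cannot vanish. *)
Lemma univalent_derive_neq0 f x l (rho : R) : 0 < rho ->
  (forall z, nr (z - x) < rho -> cdiffable f z) ->
  (forall z w, nr (z - x) < rho -> nr (w - x) < rho -> f z = f w -> z = w) ->
  cdiff f x l -> l != 0.
Proof.
move=> rho0 Hf inj Hl; apply/eqP => l0; rewrite {l}l0 in Hl.
have xr : nr (x - x) < rho by rewrite subrr nr0.
have [| | | |delta delta0 Hd] := @injective_annulus_bound f x rho (rho / 6) (rho / 3) Hf;
  try lra.
  by move=> z zr /inj; exact.
have d20 : 0 < delta / 2 by rewrite divr_gt0.
have [d d0 Hcont] := cdiff_ccont Hl d20.
(* On the annulus [nr (z - zeta) <= 2 * rho], and [nr (f z - f zeta) >= delta / 2] once [f zeta] is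
   within [delta / 2] of [f x]. *)
pose K := 2 * rho / (delta / 2).
have K0 : 0 < K by rewrite divr_gt0// mulr_gt0.
have step zeta l' : nr (zeta - x) < Num.min d (rho / 6) -> cdiff f zeta l' ->
    l' != 0 -> forall z, nr (z - x) < rho / 3 -> nr (z - zeta) <= K * nr (f z - f zeta).
  rewrite lt_min => /andP[zd zr] Hl' l'0 z zr3.
  have zrho : nr (zeta - x) < rho by lra.
  have [->|zz] := eqVneq z zeta; first by rewrite !subrr nr0 mulr0.
  pose q := fun z => (slope f zeta l' z)^-1.
  have s0 w : nr (w - x) < rho -> slope f zeta l' w != 0.
    move=> wr; rewrite /slope; have [//|wz] := eqVneq w zeta.
    rewrite mulf_neq0 ?invr_eq0 ?subr_eq0//.
    by apply/eqP => /inj wz'; move/eqP: wz; apply; apply: wz'.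
  have : nr (q z) <= K.
    apply: (@maximum_principle_removable q x zeta rho (rho / 6) (rho / 3)); try lra.
    - move=> w wr wz; have [k Hk] := slope_cdiffable l' wz (Hf _ wr).
      by eexists; exact: (@cdiffV _ (slope f zeta l') w _ (s0 _ wr) Hk).
    - apply/ccontP; apply: continuousV; first exact: s0.
      by apply/ccontP; exact: slope_ccont.
    - move=> w wr; have wd := Hd _ wr.
      have wz : w != zeta.
        by apply/eqP => wz; move: wr; rewrite wz; lra.
      rewrite /q /slope (negbTE wz) invf_div nrM nrV.
      have fwz : delta / 2 <= nr (f w - f zeta).
        by have := nr_triangle (f zeta) (f w) (f x); have := Hcont _ zd; lra.
      rewrite /K; apply: ler_pM; rewrite ?nr_ge0 ?invr_ge0 ?nr_ge0//.
        by have := nr_triangle x w zeta; rewrite (nr_distC x zeta); lra.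
      by rewrite lef_pV2 ?posrE//; lra.
  rewrite /q /slope (negbTE zz) invf_div nrM nrV ler_pdivrMr//.
  rewrite nr_gt0 subr_eq0; apply/eqP => /inj wz'; move/eqP: zz; apply; apply: wz' => //; lra.
(* Either points with nonzero derivative exist arbitrarily close to [x], or the derivative vanishes
   on a disc around [x]. *)
have [dense|] := pselect (forall s, 0 < s -> exists zeta l',
    [/\ nr (zeta - x) < s, cdiff f zeta l' & l' != 0]).
- have lim z : nr (z - x) < rho / 3 -> nr (z - x) <= K * nr (f z - f x).
    move=> zr; apply/ler_addgt0Pr => e e0.
    have eK0 : 0 < e / (2 * K) by rewrite divr_gt0// mulr_gt0.
    have [d' d'0 Hc'] := cdiff_ccont Hl eK0.
    pose s := Num.min (Num.min d (rho / 6)) (Num.min d' (e / 2)).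
    have s0 : 0 < s by rewrite !lt_min d0 d'0 !divr_gt0.
    have [zeta [l' [+ Hl' l'0]]] := dense _ s0.
    rewrite lt_min => /andP[zs]; rewrite lt_min => /andP[zd' ze].
    have H1 := step _ _ zs Hl' l'0 _ zr.
    have H2 := Hc' _ zd'.
    have H3 := nr_triangle zeta z x.
    have H4 := nr_triangle (f x) (f z) (f zeta).
    have H5 : K * nr (f z - f zeta) <= K * (nr (f z - f x) + e / (2 * K)).
      by rewrite ler_pM2l// (le_trans H4)// lerD2l nr_distC ltW.
    have H6 : K * (nr (f z - f x) + e / (2 * K)) = K * nr (f z - f x) + e / 2.
      by field; lra.
    lra.
  (* A zero derivative gives [nr (f z - f x) <= nr (z - x) / (2 * K)] near [x], against the limit
     inequality [lim]. *)
  have K20 : 0 < (2 * K)^-1 by rewrite invr_gt0 mulr_gt0.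
  have [d' d'0 Hd'] := Hl _ K20.
  pose t := Num.min (d' / 2) (rho / 6).
  have t0 : 0 < t by rewrite lt_min !divr_gt0.
  have td : t < d' by rewrite gt_min; apply/orP; left; lra.
  have tr : t <= rho / 6 by rewrite ge_min lexx orbT.
  have nt : nr (x + rc t - x) = t.
    by rewrite [x + _]addrC addrK nr_rc gtr0_norm.
  have := Hd' (x + rc t); rewrite nt mul0r subr0 => /(_ td) H1.
  have := lim (x + rc t); rewrite nt => H2.
  have : t <= K * ((2 * K)^-1 * t).
    by apply: le_trans (H2 _) _; [lra|rewrite ler_pM2l].
  have -> : K * ((2 * K)^-1 * t) = t / 2 by field; lra.
  lra.
- move=> /existsNP[s /not_implyP[s0 ns]].
  (* In this case [f] is constant near [x], against injectivity. *)
  have zero z : nr (z - x) < s -> nr (z - x) < rho -> cdiff f z 0.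
    move=> zs /Hf[k Hk]; have [<-//|k0] := eqVneq k 0.
    by exfalso; apply: ns; exists z, k.
  pose t := Num.min (s / 2) (rho / 2).
  have t0 : 0 < t by rewrite lt_min !divr_gt0.
  have ts : t < s by rewrite gt_min; apply/orP; left; lra.
  have tr : t < rho by rewrite gt_min; apply/orP; right; lra.
  have nt : nr (rc t) = t by rewrite nr_rc gtr0_norm.
  have := @cdiff_mvi _ f (fun=> 0) x (rc t) 0.
  rewrite nt mul0r => H.
  have : nr (f (x + rc t) - f x) <= 0.
    by apply: H => w wt; [apply: zero; lra|rewrite nr0].
  rewrite le_eqVlt ltNge nr_ge0 orbF nr_eq0 subr_eq0 => /eqP/inj.
  rewrite [x + _]addrC addrK nt => /(_ tr xr) /(congr1 (fun w => w - x)).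
  by rewrite addrK subrr => /(congr1 nr); rewrite nt nr0; lra.
Qed.

End univalent_maps.

(** * Discs, components and compact subsets of open sets *)

Section plane_topology.
Context {R : realType}.
Implicit Types (D U : set (CC R)) (f : CC R -> CC R).

Lemma open_discP U : open U <->
  forall z, U z -> exists2 rho : R, 0 < rho & forall w, nr (w - z) < rho -> U w.
Proof.
rewrite openE; split => H z /H; first by move=> /nbhsCP.
by move=> ?; apply/nbhsCP.
Qed.

Lemma holomorphic_onP D f : holomorphic_on D f <-> forall z, D z -> cdiffable f z.
Proof.
split=> H z /H; first by move=> /derivable_cdiff; exists (derive1 f z).
by move=> [l]; exact: cdiff_derivable.
Qed.

Lemma segment_connected_disc z (rho : R) w : nr (w - z) < rho ->
  exists S : set (CC R), [/\ connected S, S z, S w &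
    S `<=` [set v | nr (v - z) < rho]].
Proof.
move=> wz; pose p (t : R) : CC R := z + rc t * (w - z).
exists (p @` `[0, 1]); split.
- apply: connected_continuous_connected; first exact: segment_connected.
  apply: continuous_subspaceT => t S /nbhsCP[e e0 HS].
  pose k := nr (w - z) + 1; have k0 : 0 < k by have := nr_ge0 (w - z); rewrite /k; lra.
  apply/nbhs_ballP; exists (e / k) => /=; first by rewrite divr_gt0.
  move=> s; rewrite /ball /= => st; apply: HS.
  have -> : p s - p t = rc (s - t) * (w - z) by rewrite /p rcB; ring.
  rewrite nrM nr_rc; move: st; rewrite ltr_pdivlMr// distrC; apply: le_lt_trans.
  by rewrite ler_wpM2l// lerDl.
- by exists 0; rewrite /= ?in_itv /= ?lexx ?ler01// /p rc0 mul0r addr0.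
- by exists 1; rewrite /= ?in_itv /= ?lexx ?ler01// /p rc1 mul1r subrKC.
- move=> _ [t /= + <-]; rewrite in_itv /= => /andP[t0 t1].
  rewrite /p [z + _]addrC addrK nrM nr_rc ger0_norm//; apply: le_lt_trans wz.
  by rewrite ler_piMl ?nr_ge0.
Qed.

Lemma disc_domain z (rho : R) : 0 < rho ->
  domain [set w : CC R | nr (w - z) < rho].
Proof.
move=> rho0; split.
- by exists z; rewrite /= subrr nr0.
- apply/open_discP => w /= wz; exists (rho - nr (w - z)); first by rewrite subr_gt0.
  by move=> v vw; have := nr_triangle w v z; lra.
- rewrite (_ : [set _ | _] =
    connected_component [set w : CC R | nr (w - z) < rho] z).
    exact: component_connected.
  apply/seteqP; split; last exact: connected_component_sub.
  by move=> w /segment_connected_disc[S [cS Sz Sw SD]]; exists S.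
Qed.

Lemma component_domain U D : open U -> component U D -> domain D /\ D `<=` U.
Proof.
move=> /open_discP oU [z Uz ->]; split; last exact: connected_component_sub.
split; last exact: component_connected.
- by exists z; exact: connected_component_refl.
- apply/open_discP => w zw; have Uw := connected_component_sub zw.
  have [rho rho0 H] := oU _ Uw; exists rho => // v vw.
  apply: connected_component_trans zw _.
  have [S [cS Sw Sv SD]] := segment_connected_disc vw.
  by exists S => //; split=> // y /SD/H.
Qed.

(** Compactness in near-covering form, for radii tending to 0 from the right, makes the local radii
    uniform. *)
Lemma open_uniform_disc (K U : set (CC R)) : compact K -> open U -> K `<=` U ->
  exists2 e : R, 0 < e & forall z w, K z -> nr (w - z) < e -> U w.
Proof.
move=> /compact_near_coveringP cK /open_discP oU KU.
have [|e /= e0 He] := cK R 0^'+ (fun e z => forall w, nr (w - z) < e -> U w) _.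
  move=> z /KU/oU[rho rho0 H].
  have r20 : 0 < rho / 2 by rewrite divr_gt0.
  exists ([set w | nr (w - z) < rho / 2], [set e | e < rho / 2]).
    split=> /=; first by apply/nbhsCP; exists (rho / 2).
    exact: nbhs_right_lt.
  move=> [z' e] /= [z'z er] w wz'; apply: H.
  by have := nr_triangle z' w z; lra.
exists (e / 2); first by rewrite divr_gt0.
move=> z w Kz; apply: (He (e / 2)) => //=; last by rewrite divr_gt0.
by rewrite sub0r normrN gtr0_norm; lra.
Qed.

End plane_topology.

(** * Contraction of words on the attractor *)

Section attractor_of_IFS.
Context {R : realType} {m : nat}.
Variables (g : 'I_m -> CC R -> CC R) (Om A : set (CC R)).
Hypotheses (hg : holomorphic_IFS g Om) (hA : attractor g Om A).

Let Om_open : open Om. Proof. by case: hg => -[]. Qed.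
Let Om_connected : connected Om. Proof. by case: hg => -[]. Qed.
Let A0 : A !=set0. Proof. by case: hA. Qed.
Let A_compact : compact A. Proof. by case: hA. Qed.
Let A_Om : A `<=` Om. Proof. by case: hA. Qed.
Let A_fix : A = \bigcup_i g i @` A. Proof. by case: hA. Qed.

Lemma IFS_map i z : Om z -> Om (g i z).
Proof. by case: hg => _ _ /(_ i)[H _ _] Omz; apply: H; exists z. Qed.

Lemma IFS_cdiffable i z : Om z -> cdiffable (g i) z.
Proof. by case: hg => _ _ /(_ i)[_ [/holomorphic_onP H _] _] /H. Qed.

Lemma IFS_inj i z w : Om z -> Om w -> g i z = g i w -> z = w.
Proof.
case: hg => _ _ /(_ i)[_ [_ H] _] Oz Ow gE.
by apply: (H _ _ _ _ gE); rewrite inE.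
Qed.

Lemma IFS_bounded : exists2 M : R, 0 < M & forall z, Om z -> nr z <= M.
Proof.
case: hg => _ [M0 [M0r HM0]] _.
have := HM0 (M0 + 1); rewrite ltrDl ltr01 => /(_ isT) H.
exists (nr (M0 + 1) + 1); first by have := nr_ge0 (M0 + 1); lra.
move=> z /H /= zM; suff : nr z <= nr (M0 + 1) by lra.
have : `|z| <= `|M0 + 1|.
  by apply: le_trans zM _; apply: real_ler_norm; exact: realD M0r (real1 _).
by rewrite !norm_nr /rc lecR.
Qed.

Lemma IFS_margin : exists2 eta : R, 0 < eta &
  forall i z w, Om z -> nr (w - g i z) < eta -> Om w.
Proof.
have [M M0 HM] := IFS_bounded.
have : forall i, exists eta : R, 0 < eta /\
    forall z w, Om z -> nr (w - g i z) < eta -> Om w.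
  move=> i; have cK : compact (closure (g i @` Om)).
    apply: (@compact_bounded_closed _ _ M); first exact: closed_closure.
    by move=> z; case: hg => _ _ /(_ i)[_ _ H] /H/HM.
  have [|e e0 He] := open_uniform_disc cK Om_open.
    by case: hg => _ _ /(_ i)[].
  exists e; split=> // z w Oz; apply: He; apply: subset_closure; exists z => //.
move=> /choice[eta Heta].
exists (\big[Num.min/1]_i eta i).
  elim/big_ind: _ => // [x y x0 y0|i _]; first by rewrite lt_min x0.
  exact: (Heta i).1.
move=> i z w Oz wz; apply: (Heta i).2 Oz _; apply: lt_le_trans wz _.
exact: bigmin_le_cond.
Qed.

Lemma word_map_cat (u v : seq 'I_m) z :
  word_map g (u ++ v) z = word_map g u (word_map g v z).
Proof. by elim: u => //= i u IH; rewrite /= IH. Qed.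

Lemma word_map_Om w z : Om z -> Om (word_map g w z).
Proof. by move=> Oz; elim: w => //= i w IH; exact: IFS_map. Qed.

Lemma word_map_cdiffable w z : Om z -> cdiffable (word_map g w) z.
Proof.
move=> Oz; elim: w => [|i w [l Hl]]; first by exists 1; exact: cdiff_id.
have [k Hk] := IFS_cdiffable i (word_map_Om w Oz).
by exists (k * l); exact: (cdiff_comp Hl Hk).
Qed.

Lemma word_map_inj w x y : Om x -> Om y -> word_map g w x = word_map g w y -> x = y.
Proof.
move=> Ox Oy; elim: w => //= i w IH /IFS_inj H; apply: IH; apply: H;
  exact: word_map_Om.
Qed.

Lemma attractor_image i a : A a -> A (g i a).
Proof. by move=> Aa; rewrite A_fix; exists i => //; exists a. Qed.

Lemma word_map_attractor w a : A a -> A (word_map g w a).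
Proof. by move=> Aa; elim: w => //= i w; exact: attractor_image. Qed.

Lemma attractor_word k a : A a ->
  exists w b, [/\ size w = k, A b & a = word_map g w b].
Proof.
elim: k a => [|k IH] a Aa; first by exists [::], a.
have [i _ [b Ab <-]] : (\bigcup_i g i @` A) a by rewrite -A_fix.
have [w [c [wk Ac ->]]] := IH _ Ab.
by exists (i :: w), c; split=> //=; rewrite wk.
Qed.

(* Earle-Hamilton: composing the maps [lam * g i - (lam - 1) * g i p] instead of
   the [g i] still stays in [Om] and multiplies each derivative by [lam]. *)
Lemma word_map_expansion : exists2 lam : R, 1 < lam &
  forall w x, Om x -> exists F l,
    [/\ forall z, Om z -> Om (F z), forall z, Om z -> cdiffable F z,
        F x = word_map g w x, cdiff (word_map g w) x l &
        cdiff F x (rc lam ^+ size w * l)].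
Proof.
have [M M0 HM] := IFS_bounded; have [eta eta0 Heta] := IFS_margin.
(* Pushing away from [p] moves a point by at most [e * (2 * M) < eta], which stays within the
   margin. *)
pose e := eta / (2 * M + 1).
have M1 : 0 < 2 * M + 1 by lra.
have e0 : 0 < e by rewrite divr_gt0.
exists (1 + e); first lra.
move=> w x Ox; elim: w => [|i w [F [l [FO dF Fx Hl HF]]]].
  exists id, 1; split=> //=; first by move=> z _; exists 1; exact: cdiff_id.
    exact: cdiff_id.
  by rewrite expr0 mulr1; exact: cdiff_id.
set p := g i (word_map g w x).
have Op : Om p by apply: IFS_map; exact: word_map_Om.
have [k Hk] := IFS_cdiffable i (word_map_Om w Ox).
have dq z k' : cdiff (g i) z k' ->
    cdiff (fun z => rc (1 + e) * g i z - rc e * p) z (rc (1 + e) * k').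
  by move=> H; have := cdiffB (cdiffZ (rc (1 + e)) H) (@cdiff_cst _ (rc e * p) z);
     rewrite subr0.
exists (fun z => rc (1 + e) * g i (F z) - rc e * p), (k * l); split.
- move=> z /FO OF; apply: (Heta i (F z)) => //.
  have -> : rc (1 + e) * g i (F z) - rc e * p - g i (F z) = rc e * (g i (F z) - p).
    by rewrite rcD rc1; ring.
  rewrite nrM nr_rc gtr0_norm//.
  have : nr (g i (F z) - p) <= 2 * M.
    have := nrB (g i (F z)) p; have := HM _ Op; have := HM _ (IFS_map i OF); lra.
  move=> H; apply: (@le_lt_trans _ _ (e * (2 * M))); first by rewrite ler_pM2l.
  by rewrite /e mulrAC ltr_pdivrMr// ltr_pM2l// ltrDl.
- move=> z Oz; have [k' Hk'] := IFS_cdiffable i (FO _ Oz); have [l' Hl'] := dF _ Oz.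
  by eexists; exact: (cdiff_comp Hl' (dq _ _ Hk')).
- by rewrite Fx -/p rcD rc1 mulrDl mul1r addrK.
- exact: (cdiff_comp Hl Hk).
- rewrite -Fx in Hk; have := cdiff_comp HF (dq _ _ Hk).
  by congr cdiff; rewrite /= exprS; ring.
Qed.

(** The Cauchy estimate for the expanded self-map of [Om] bounds [lam ^+ size w * nr l] by
    [12 * M / rho]. *)
Lemma word_map_derive_bound : exists2 lam : R, 1 < lam &
  exists2 C : R, 0 < C & forall w x rho l, 0 < rho ->
    (forall z, nr (z - x) < rho -> Om z) -> cdiff (word_map g w) x l ->
    nr l <= C / rho / lam ^+ size w.
Proof.
have [M M0 HM] := IFS_bounded; have [lam lam1 H] := word_map_expansion.
have lam0 : 0 < lam by lra.
exists lam => //; exists (12 * M); first lra.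
move=> w x rho l rho0 Hrho Hl.
have Ox : Om x by apply: Hrho; rewrite subrr nr0.
have [F [l' [FO dF Fx Hl' HF]]] := H w x Ox.
have ll := cdiff_uniq Hl Hl'; rewrite -{l' Hl'}ll in HF.
rewrite ler_pdivlMr ?exprn_gt0//.
have := @cauchy_estimate _ F x _ rho M rho0 _ _ HF.
rewrite nrM nrX nr_rc gtr0_norm// mulrC; apply.
- by move=> z /Hrho/dF.
- by move=> z /Hrho/FO/HM.
Qed.

(** The derivative bound compares points within a small disc. Since [A] need not be connected,
    comparisons are chained through the connected set [Om], and compactness of [A] makes the
    constant uniform. *)
Lemma word_map_contraction : exists2 lam : R, 1 < lam &
  exists2 C : R, 0 < C & forall w x y, A x -> A y ->
    nr (word_map g w x - word_map g w y) <= C / lam ^+ size w.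
Proof.
have [lam lam1 [C C0 HC]] := word_map_derive_bound; exists lam => //.
have lam0 : 0 < lam by lra.
pose close x y C := forall w, nr (word_map g w y - word_map g w x) <= C / lam ^+ size w.
have local x : Om x -> exists2 rho : R, 0 < rho &
    forall y, nr (y - x) < rho -> Om y /\ close x y C.
  (* On the disc of radius [rho / 2] around [x] the derivative is at most
     [C / (rho / 2) / lam ^+ size w], and the displacement is less than [rho / 2]. *)
  move=> Ox; have [rho rho0 Hrho] := (open_discP Om).1 Om_open _ Ox.
  exists (rho / 2); first by rewrite divr_gt0.
  move=> y yx; split=> [|w]; first by apply: Hrho; lra.
  have H z : nr (z - x) <= nr (y - x) ->
      cdiff (word_map g w) z (derive1 (word_map g w) z).
    move=> zx; have [|l Hl] := word_map_cdiffable w (z := z).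
      by apply: Hrho; lra.
    by rewrite (cdiff_derive1 Hl).
  have := cdiff_mvi (M := C / (rho / 2) / lam ^+ size w) H.
  rewrite subrKC => H1; apply: (le_trans (H1 _)).
    move=> z zx; apply: HC (H _ zx); first by rewrite divr_gt0.
    by move=> v vz; apply: Hrho; have := nr_triangle z v x; lra.
  rewrite mulrAC ler_pM2r ?invr_gt0 ?exprn_gt0// -mulrA -[X in _ <= X]mulr1 ler_pM2l//.
  by rewrite mulrC ler_pdivrMr ?divr_gt0// mul1r ltW.
have close_tr x y z C1 C2 : close x y C1 -> close y z C2 -> close x z (C2 + C1).
  move=> H1 H2 w; rewrite mulrDl; apply: le_trans (nr_triangle (word_map g w y) _ _) _.
  exact: lerD.
have close_sym x y C1 : close x y C1 -> close y x C1.
  by move=> H w; rewrite nr_distC.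
have [a Aa] := A0.
(* The points comparable with [a] form a nonempty subset of [Om], open and relatively closed, hence
   all of [Om]. *)
pose B := [set y | Om y /\ exists C1, close a y C1].
have BE : B = Om.
  have oB : open B.
    apply/open_discP => y [Oy [C1 HC1]]; have [rho rho0 H] := local _ Oy.
    exists rho => // z /H[Oz zy]; split => //; exists (C + C1); exact: close_tr zy.
  have oB' : open (Om `\` B).
    apply/open_discP => y [Oy nBy]; have [rho rho0 H] := local _ Oy.
    exists rho => // z /H[Oz zy]; split => // -[_ [C1 HC1]]; apply: nBy.
    split=> //; exists (C + C1); exact: close_tr HC1 (close_sym _ _ _ zy).
  apply: Om_connected.
  - exists a; split; first exact: A_Om.
    by exists 0 => w; rewrite subrr nr0 mul0r.
  - by exists B => //; apply/seteqP; split=> [y [Oy ?]//|y []//].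
  - exists (~` (Om `\` B)); first exact: open_closedC.
    apply/seteqP; split=> [y By|y [Oy nn]].
      by split; [case: By|case].
    by apply: contrapT => nBy; apply: nn.
(* Near covering for constants tending to infinity: one constant serves all of [A]. *)
have [|N [Nr HN]] := (compact_near_coveringP A).1 A_compact R +oo
    (fun C1 y => close a y C1) _.
  move=> y /A_Om Oy; have [rho rho0 H] := local _ Oy.
  have : B y by rewrite BE.
  move=> [_ [C1 HC1]].
  exists ([set z | nr (z - y) < rho], [set D | C + C1 < D]).
    split=> /=; first by apply/nbhsCP; exists rho.
    by exists (C + C1); split => //; exact: num_real.
  move=> [z D] /= [/H[_ zy] CD] w; apply: (le_trans (close_tr _ _ _ _ _ HC1 zy w)).
  by rewrite ler_pM2r ?invr_gt0 ?exprn_gt0// ltW.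
pose N1 := `|N| + 1.
have NN1 : N < N1 by rewrite /N1; have := ler_norm N; lra.
exists (N1 + N1); first by rewrite addr_gt0// ltr_wpDl.
move=> w x y Ax Ay.
exact: close_tr (close_sym _ _ _ (HN _ NN1 _ Ay)) (HN _ NN1 _ Ax) w.
Qed.

Lemma word_map_small (e : R) : 0 < e -> exists N, forall w x y,
  (N <= size w)%N -> A x -> A y -> nr (word_map g w x - word_map g w y) < e.
Proof.
move=> e0; have [lam lam1 [C C0 HC]] := word_map_contraction.
have lam0 : 0 < lam by lra.
have [N HN] := expr_unbounded (C / e) lam1; exists N => w x y Nw Ax Ay.
apply: le_lt_trans (HC _ _ _ Ax Ay) _.
rewrite ltr_pdivrMr ?exprn_gt0// mulrC -ltr_pdivrMr//.
by apply: lt_le_trans HN _; rewrite ler_eXn2l.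
Qed.

(** * Fixed points of words: existence, attraction, density *)

Definition word_pow n (w : seq 'I_m) : seq 'I_m := flatten (nseq n w).

Lemma size_word_pow n w : size (word_pow n w) = (n * size w)%N.
Proof. by elim: n => //= n IH; rewrite size_cat IH. Qed.

Lemma word_map_powC n w z :
  word_map g (word_pow n w) (word_map g w z) = word_map g w (word_map g (word_pow n w) z).
Proof. by elim: n => //= n IH; rewrite !word_map_cat IH. Qed.

(** A minimizer [c] of the displacement on [A] is fixed: the displacement at the image of [c] under
    a high power of [w] is the distance between two points of one small piece. *)
Lemma word_map_fixed_point w : w <> [::] -> exists2 b, A b & word_map g w b = b.
Proof.
move=> w0; have [|c] := compact_EVT_min A0 A_compact
    (f := fun z => nr (word_map g w z - z)).
  apply: continuous_in_subspaceT => z; rewrite inE => /A_Om Oz.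
  have [l Hl] := word_map_cdiffable w Oz.
  have /ccontP := cdiff_ccont (cdiffB Hl (@cdiff_id _ z)).
  move=> H; apply: continuous_comp H _.
  have := @continuous_nr_sub R 0 (word_map g w z - z).
  by congr continuous_at; apply/funext => v; rewrite subr0.
rewrite inE => Ac Hc; exists c => //; apply/eqP; rewrite -subr_eq0; apply/eqP.
apply: nr_small => e e0; have [N HN] := word_map_small e0.
pose p := word_map g (word_pow N w) c.
have Ap : A p by exact: word_map_attractor.
apply: le_trans (Hc p _) _; first by rewrite inE.
rewrite -word_map_powC; apply/ltW/HN => //; last exact: word_map_attractor.
by rewrite size_word_pow leq_pmulr//; case: (w) w0.
Qed.

(** Univalence makes the derivative [l] nonzero. The n-th power of [w] has derivative [l ^+ n] at
    [b], which must decay geometrically, so [nr l < 1]. *)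
Lemma word_map_attracting w b : w <> [::] -> A b -> word_map g w b = b ->
  0 < `|derive1 (word_map g w) b| < 1.
Proof.
move=> w0 /A_Om Ob wb; have [l Hl] := word_map_cdiffable w Ob.
have [rho rho0 Hrho] := (open_discP Om).1 Om_open _ Ob.
rewrite (cdiff_derive1 Hl) norm_nr -rc0 -rc1 !ltcR; apply/andP; split.
  rewrite nr_gt0; apply: (@univalent_derive_neq0 _ (word_map g w) b l rho) => //.
    by move=> z /Hrho; exact: word_map_cdiffable.
  by move=> z v /Hrho Oz /Hrho Ov; exact: word_map_inj.
have Hn n : cdiff (word_map g (word_pow n w)) b (l ^+ n) /\
    word_map g (word_pow n w) b = b.
  elim: n => [|n [IH1 IH2]]; first by split=> //; rewrite expr0; exact: cdiff_id.
  split; last by rewrite /= word_map_cat IH2.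
  have := cdiff_comp IH1 (g := word_map g w); rewrite IH2 => /(_ _ Hl).
  rewrite -exprS; congr cdiff; apply/funext => z.
  by rewrite /= word_map_cat.
rewrite ltNge; apply/negP => l1.
have [lam lam1 [C C0 HC]] := word_map_derive_bound.
have lam0 : 0 < lam by lra.
have [n Hlam] := expr_unbounded (C / rho) lam1.
have := HC _ _ _ _ rho0 Hrho (Hn n).1; apply/negP; rewrite -ltNge nrX.
apply: (@lt_le_trans _ _ 1); last exact: exprn_ege1.
rewrite ltr_pdivrMr ?exprn_gt0// mul1r (lt_le_trans Hlam)// ler_eXn2l//.
by rewrite size_word_pow leq_pmulr//; case: (w) w0.
Qed.

Lemma dense_fixed_points a (e : R) : A a -> 0 < e -> exists w b,
  [/\ w <> [::], A b, word_map g w b = b & nr (b - a) < e].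
Proof.
move=> Aa e0; have [N HN] := word_map_small e0.
(* Length [N.+1] makes the word nonempty; [a] and the fixed point both lie in the piece of [w]. *)
have [w [c [wN Ac ->]]] := attractor_word N.+1 Aa.
have w0 : w <> [::] by move=> w0; rewrite w0 in wN.
have [b Ab wb] := word_map_fixed_point w0.
by exists w, b; split=> //; rewrite -{1}wb; apply: HN => //; rewrite wN.
Qed.

(** * Preimages of attractor points, and density of forward-invariant open sets *)

Section preimage.
Variable U : set (CC R).
Hypotheses (oU : open U) (UOm : U `<=` Om) (AU : A `<=` closure U)
  (gU : trivIset setT (fun i => g i @` U)).

Lemma attractor_preimage i x : U x -> A (g i x) -> A x.
Proof.
move=> Ux; rewrite {1}A_fix => -[j _ [a Aa gax]].
have [ij|/eqP ij] := eqVneq j i.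
  by rewrite ij in gax; rewrite -(IFS_inj (A_Om Aa) (UOm Ux) gax).
exfalso; apply: ij.
have [rho rho0 Hrho] := (open_discP U).1 oU _ Ux.
have [||eta eta0 Heta] := @univalent_open _ (g i) x rho rho0.
- by move=> z /Hrho/UOm; exact: IFS_cdiffable.
- by move=> z /Hrho/UOm Oz; apply: IFS_inj => //; exact: UOm.
have [k /cdiff_ccont/(_ _ eta0)[d d0 Hd]] := IFS_cdiffable j (A_Om Aa).
have /(AU Aa)[y [Uy /= ya]] : nbhs a [set y | nr (y - a) < d].
  by apply/nbhsCP; exists d.
have Hy : nr (g j y - g i x) < eta by rewrite -gax; exact: Hd.
have [z /Hrho Uz gz] := Heta _ Hy.
by apply: (gU (i := j) (j := i)) => //; exists (g j y); split; [exists y|exists z].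
Qed.

End preimage.

(** Long words carry a point of [A] in [O] arbitrarily close to any point of [A], and its images
    stay in [O]. *)
Lemma attractor_sub_closure (O : set (CC R)) : A `&` O !=set0 ->
  (forall i, g i @` O `<=` O) -> A `<=` closure O.
Proof.
move=> [p [Ap Op]] gO a Aa S /nbhsCP[e e0 HS].
have [N HN] := word_map_small e0.
have [w [c [wN Ac ac]]] := attractor_word N Aa.
exists (word_map g w p); split.
  by elim: w {wN ac} => //= i w IH; apply: (gO i); exists (word_map g w p).
by apply: HS; rewrite ac; apply: HN => //; rewrite wN.
Qed.

End attractor_of_IFS.

(** * Compact, perfect, totally separated plane sets are Cantor sets *)

Section planar_cantor_sets.
Context {R : realType}.
Variables (A : set (CC R)) (a0 : CC R).
Hypotheses (Aa0 : A a0) (A_compact : compact A)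
  (A_perfect : forall a (e : R), A a -> 0 < e ->
     exists b, [/\ A b, b <> a & nr (b - a) < e])
  (A_separated : forall a b, A a -> A b -> a <> b ->
     exists S : set (CC R), [/\ S a, ~ S b &
       forall z, A z -> exists2 e : R, 0 < e &
         forall w, A w -> nr (w - z) < e -> S w <-> S z]).

Let coord (z : A) : R * R := (ReC (\val z), ImC (\val z)).
(* The pseudometric of [CC R] has its radii in [CC R]; this copy of [A] has a
   pseudometric with radii in [R]. *)
Let W := initial_topology coord.
Let elt z (Az : A z) : A := exist _ z (mem_set Az).

Let valA (x : A) : A (\val x).
Proof. by case: x => z /= /set_mem. Qed.

Let nbhsWP (x : W) (S : set W) : nbhs x S <-> exists2 e : R, 0 < e &
  forall y : A, nr (\val y - \val (x : A)) < e -> S y.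
Proof.
split.
  move=> /nbhs_ballP[e /= e0 H]; exists e => // y yx; apply: H.
  rewrite -initial_ballE; split; rewrite /ball /= distrC -?ReB -?ImB;
    apply: le_lt_trans yx; [exact: Re_le_nr|exact: Im_le_nr].
move=> [e e0 H]; apply/nbhs_ballP; exists (e / 2) => /=; first by rewrite divr_gt0.
move=> y; rewrite -initial_ballE => -[]; rewrite /ball /= => H1 H2; apply: H.
by apply: (le_lt_trans (nr_le_ReIm _)); rewrite ReB ImB distrC [X in _ + X]distrC; lra.
Qed.

Let openWP (S : set W) : open S <-> forall x : W, S x -> exists2 e : R, 0 < e &
  forall y : A, nr (\val y - \val (x : A)) < e -> S y.
Proof.
by rewrite openE; split=> H x /H; [move/nbhsWP|move=> ?; apply/nbhsWP].
Qed.

(** Checks the topological characterization of the Cantor space on the copy [W] of [A]: perfect,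
    compact, Hausdorff and zero-dimensional. *)
Lemma compact_perfect_separated_cantor : cantor_set A.
Proof.
pose T : pseudoPMetricType R := HB.pack_for (pseudoPMetricType R) (initial_topology coord)
  (isPointed.Build W (elt Aa0)).
have cT : cantor_like T.
  split.
  - apply/perfectTP => x /openWP/(_ x erefl)[e e0 He].
    have [b [Ab bx be]] := A_perfect (valA x) e0.
    have := He (elt Ab) be => bxE; apply: bx.
    by rewrite -bxE.
  - apply/compact_near_coveringP => I F P FF H.
    have HF : \forall i \near F, A `<=` [set z | forall Az : A z, P i (elt Az)].
      apply: ((compact_near_coveringP A).1 A_compact I F
        (fun i z => forall Az : A z, P i (elt Az)) FF).
      move=> z Az; have [[S Q] /= [SN QF] SQ] := H (elt Az) Logic.I.
      have [e e0 He] := (nbhsWP _ _).1 SN.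
      exists ([set w | nr (w - z) < e], Q).
        by split=> //=; apply/nbhsCP; exists e.
      move=> [w i] /= [we Qi] Aw; apply: (SQ (elt Aw, i)); split=> //=.
      exact: He.
    apply: filterS HF => i Hi x _.
    have := Hi _ (valA x) (valA x); congr (P i _); exact: val_inj.
  - move=> x y xy; apply/val_inj/eqP; rewrite -subr_eq0 -nr_eq0.
    have := nr_ge0 (\val (x : A) - \val (y : A)); rewrite le_eqVlt eq_sym.
    case/orP => // xy0.
    pose e := nr (\val (x : A) - \val (y : A)) / 2.
    have e0 : 0 < e by rewrite divr_gt0.
    have [||z [zx zy]] := xy [set z : W | nr (\val (z : A) - \val (x : A)) < e]
      [set z : W | nr (\val (z : A) - \val (y : A)) < e].
    + by apply/nbhsWP; exists e.
    + by apply/nbhsWP; exists e.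
    have := nr_triangle (\val (z : A)) (\val (x : A)) (\val (y : A)).
    rewrite /= nr_distC in zx; rewrite /= in zy.
    rewrite (nr_distC (\val (x : A)) (\val (z : A))) nr_distC in zx *.
    by rewrite /e in zx zy; lra.
  - move=> x y /eqP xy; have [|S [Sx Sy HS]] := A_separated (valA x) (valA y).
      by move=> /val_inj.
    exists [set z : W | S (\val (z : A))]; split=> //; split.
      apply/openWP => z Sz; have [e e0 He] := HS _ (valA z).
      by exists e => // w wz; apply/(He _ (valA w) wz).
    rewrite -openC; apply/openWP => z Sz; have [e e0 He] := HS _ (valA z).
    by exists e => // w wz /= Sw; apply: Sz; apply/(He _ (valA w) wz).
have [f [cf clf]] := homeomorphism_cantor_like cT.
(* The value [point] outside [A] is arbitrary: continuity of [h] is only claimed within [A]. *)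
pose h (z : CC R) : cantor_space :=
  if pselect (A z) is left Az then f^-1%FUN (elt Az) else point.
have fK : cancel f f^-1%FUN by move=> x; apply: funK; rewrite inE.
have Kf : cancel f^-1%FUN f by move=> x; apply: invK; rewrite inE.
have hE z (Az : A z) : h z = f^-1%FUN (elt Az).
  by rewrite /h; case: pselect => // Az'; congr (f^-1%FUN _); exact: val_inj.
exists (fun c => \val (f c : A)), h; split.
- move=> c; apply: (@continuous_comp _ W _ f (fun z : W => \val (z : A))).
    exact: cf.
  move=> S /nbhsCP[e e0 He]; apply/nbhsWP; exists e => // y; exact: He.
- apply/seteqP; split=> [_ [c _ <-]|z Az]; first exact: valA.
  by exists (f^-1%FUN (elt Az)) => //; rewrite Kf.
- move=> c; rewrite (hE _ (valA _)).
  by rewrite -[RHS]fK; congr (f^-1%FUN _); exact: val_inj.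
(* The inverse is continuous because [f] maps closed sets to closed sets. *)
- have ci : continuous (f^-1%FUN : W -> cantor_space).
    apply/continuousP => S oS; rewrite -closedC.
    rewrite (_ : ~` _ = f @` (~` S)); first by apply: clf; exact: open_closedC.
    apply/seteqP; split=> [x nSx|_ [c nSc <-] /=]; last by rewrite fK.
    by exists (f^-1%FUN x).
  rewrite continuous_subspace_in => z; rewrite inE => Az S.
  rewrite /from_subspace (hE _ Az) => /ci/nbhsWP[e e0 He].
  rewrite /= nbhs_filterE /nbhs /= -nbhs_subspace_in// /within /=.
  apply/nbhsCP; exists e => // w we Aw; rewrite /preimage /= (hE _ Aw).
  exact: (He (elt Aw) we).
Qed.

End planar_cantor_sets.

(** * Strong separation: Cantor structure and local symmetries *)

Section strong_separation.
Context {R : realType} {m : nat}.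
Variables (g : 'I_m -> CC R -> CC R) (Om A : set (CC R)).
Hypotheses (hg : holomorphic_IFS g Om) (hA : attractor g Om A).
Hypothesis (hA2 : at_least_two A).

Let Om_open : open Om. Proof. by case: hg => -[]. Qed.
Let A_compact : compact A. Proof. by case: hA. Qed.
Let A_Om : A `<=` Om. Proof. by case: hA. Qed.
Let A_fix : A = \bigcup_i g i @` A. Proof. by case: hA. Qed.

Lemma word_image_closed w : closed (word_map g w @` A).
Proof.
apply: compact_closed; first exact: norm_hausdorff.
apply: continuous_compact A_compact; apply: continuous_in_subspaceT => z.
rewrite inE => /A_Om Oz; have [l Hl] := word_map_cdiffable hg w Oz.
by apply/ccontP; exact: cdiff_ccont Hl.
Qed.

(** A small piece containing [a] also contains the image of a second point of [A], distinct from [a]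
    by injectivity. *)
Lemma attractor_perfect a (e : R) : A a -> 0 < e ->
  exists b, [/\ A b, b <> a & nr (b - a) < e].
Proof.
move=> Aa e0; have [N HN] := word_map_small hg hA e0.
have [w [c [wN Ac ->]]] := attractor_word hA N Aa.
have [c' Ac' cc'] : exists2 c', A c' & c' <> c.
  have [x [y [Ax Ay xy]]] := hA2.
  by have [<-|] := eqVneq x c; [exists y => //; exact: nesym|move/eqP; exists x].
exists (word_map g w c'); split.
- exact: (word_map_attractor hA).
- by move=> /(word_map_inj hg (A_Om Ac') (A_Om Ac)).
- by apply: HN => //; rewrite wN.
Qed.

Hypothesis ssc : strong_separation g A.

(** The other pieces are closed and miss [g i c], so for [y] near [c] only the piece of index [i]
    can contain [g i y]. *)
Lemma ssc_local i c : A c -> exists2 rho : R, 0 < rho &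
  forall y, nr (y - c) < rho -> Om y /\ (A (g i y) -> A y).
Proof.
move=> Ac; have Oc := A_Om Ac.
have /nbhsCP[rho rho0 H] : \forall y \near c, forall j, j != i -> ~ (g j @` A) (g i y).
  apply: (@filter_forall _ _ (fun j y => j != i -> ~ (g j @` A) (g i y)) (nbhs c) _) => j.
  have [->|ji] := eqVneq j i.
    by apply: nearW => y; rewrite ?eqxx.
  have cl : open (~` (g j @` A)).
    by have := @word_image_closed [:: j]; exact: closed_openC.
  have [l /cdiff_ccont/ccontP ci] := IFS_cdiffable hg i Oc.
  have : nbhs (g i c) (~` (g j @` A)).
    apply: open_nbhs_nbhs; split=> // gjc; move/eqP: ji; apply.
    by apply: (ssc (i := j) (j := i)) => //; exists (g i c); split=> //; exists c.
  move=> /ci Hn; have {}Hn : nbhs c [set y | ~ (g j @` A) (g i y)] by exact: Hn.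
  by apply: filterS Hn => y ny _.
have [rho' rho'0 H'] := (open_discP Om).1 Om_open _ Oc.
exists (Num.min rho rho'); first by rewrite lt_min rho0.
move=> y; rewrite lt_min => /andP[/H yr /H' Oy]; split=> //.
rewrite {1}A_fix => -[j _ gy]; have [ji|/yr//] := eqVneq j i.
by case: gy => a Aa; rewrite ji => /(IFS_inj hg (A_Om Aa) Oy) <-.
Qed.

Lemma ssc_word_local w b : A b -> exists2 rho : R, 0 < rho &
  forall x, nr (x - b) < rho -> Om x /\ (A (word_map g w x) -> A x).
Proof.
move=> Ab; elim: w => [|i w [rho rho0 IH]].
  have [rho rho0 H] := (open_discP Om).1 Om_open _ (A_Om Ab).
  by exists rho => // x /H.
have [rho' rho'0 H'] := ssc_local i (word_map_attractor hA w Ab).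
have [l /cdiff_ccont/(_ _ rho'0)[d d0 Hd]] := word_map_cdiffable hg w (A_Om Ab).
exists (Num.min rho d); first by rewrite lt_min rho0.
move=> x; rewrite lt_min => /andP[/IH[Ox Hx] /Hd/H'[_ Hi]]; split=> //.
by move=> /Hi.
Qed.

(** Pieces are relatively open in [A]: by openness of [g i], a nearby point of [A] is [g i y] with
    [y] close to [c1], and [ssc_local] puts [y] in [A]. *)
Lemma ssc_word_image_open w c : A c -> exists2 e : R, 0 < e &
  forall z, A z -> nr (z - word_map g w c) < e -> (word_map g w @` A) z.
Proof.
move=> Ac; elim: w => [|i w [e e0 IH]]; first by exists 1 => // z Az _; exists z.
set c1 := word_map g w c in IH.
have Ac1 : A c1 by exact: (word_map_attractor hA).
have [rho rho0 H] := ssc_local i Ac1.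
have r0 : 0 < Num.min rho e by rewrite lt_min rho0.
have [||eta eta0 Heta] := @univalent_open _ (g i) c1 _ r0.
- by move=> y; rewrite lt_min => /andP[/H[Oy _] _]; exact: (IFS_cdiffable hg).
- move=> y; rewrite lt_min => /andP[/H[Oy _] _].
  by apply: (IFS_inj hg Oy); exact: A_Om.
exists eta => // z Az /Heta[y + gy]; rewrite lt_min => /andP[/H[_ Hy] ye].
have Ay : A y by apply: Hy; rewrite gy.
by have [a Aa ay] := IH _ Ay ye; exists a => //=; rewrite ay.
Qed.

Lemma ssc_cantor_set : cantor_set A.
Proof.
have [a0 Aa0] : A !=set0 by case: hA.
apply: (compact_perfect_separated_cantor Aa0 A_compact attractor_perfect).
move=> a b Aa Ab ab; have ab0 : 0 < nr (b - a).
  by rewrite nr_gt0 subr_eq0; apply/eqP => ba; apply: ab.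
(* A piece containing [a] of diameter too small to reach [b] is the required relatively clopen
   separator. *)
have [N HN] := word_map_small hg hA ab0.
have [w [c [wN Ac ac]]] := attractor_word hA N Aa.
exists (word_map g w @` A); split.
- by exists c.
- move=> [c' Ac' bc']; have := HN w c' c; rewrite wN bc' -ac ltxx.
  by move=> /(_ (leqnn _) Ac' Ac).
- move=> z Az; have [[d Ad <-]|nz] := pselect ((word_map g w @` A) z).
    have [e e0 He] := ssc_word_image_open w Ad.
    by exists e => // v Av vz; split=> _; [exists d|exact: He].
  have : nbhs z (~` (word_map g w @` A)).
    by apply: open_nbhs_nbhs; split=> //; apply: closed_openC; exact: word_image_closed.
  by move=> /nbhsCP[e e0 He]; exists e => // v _ /He nv; split.
Qed.

(** Fixed points of words are dense in [A], and each word is a symmetry on a small disc around its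
    fixed point. *)
Lemma ssc_J_like : J_like A.
Proof.
move=> a Aa S /nbhsCP[e e0 HS].
have [w [b [w0 Ab wb ba]]] := dense_fixed_points hg hA Aa e0.
exists b; split; last exact: HS.
split=> //; have [rho rho0 H] := ssc_word_local w Ab.
have bb : nr (b - b) < rho by rewrite subrr nr0.
exists [set x : CC R | nr (x - b) < rho], (word_map g w); split; last first.
  by split=> //; exact: (word_map_attracting hg hA).
split; first exact: disc_domain.
- by exists b.
- apply/holomorphic_onP => z /H[Oz _]; exact: (word_map_cdiffable hg).
- move=> x xb; split=> [[_ Ax]|[_ Awx]]; split=> //.
  + exact: (word_map_attractor hA).
  + exact: (H _ xb).2.
Qed.

End strong_separation.

(** * Symmetries and J-likeness under the three separation hypotheses *)

Theorem lemma3p3 (R : realType) (m : nat) (g : 'I_m -> CC R -> CC R)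
    (Om A : set (CC R))
    (hg : holomorphic_IFS g Om) (hA : attractor g Om A)
    (hA2 : at_least_two A) :
  [/\ strong_separation g A -> J_like A /\ cantor_set A,
      forall U : set (CC R),
        open U -> U `<=` Om -> A `<=` closure U -> A `&` U !=set0 ->
        trivIset setT (fun i => g i @` U) ->
        forall D : set (CC R), component U D -> D `&` A !=set0 ->
        forall i, symmetry A D (g i)
    & forall O : set (CC R),
        O `<=` Om -> strong_open_set_condition g A O ->
        forall D : set (CC R), component O D -> D `&` A !=set0 ->
        (forall w : seq 'I_m, w <> [::] -> symmetry A D (word_map g w)) /\
        J_like_relative A D].
Proof.
split.
- by move=> ssc; split; [exact: (ssc_J_like hg hA)|exact: (ssc_cantor_set hg hA)].
- move=> U oU UOm AU _ gU D /(component_domain oU)[domD DU] DA i; split=> //.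
    by apply/holomorphic_onP => z /DU/UOm; exact: (IFS_cdiffable hg).
  move=> x Dx; split=> [[_ Ax]|[_ Agx]]; split=> //.
  + exact: (attractor_image hA).
  + exact: (attractor_preimage hg hA oU UOm AU gU (DU _ Dx) Agx).
- move=> O OOm [oO AO gO gdisj] D /(component_domain oO)[domD DO] DA.
  have AclO := attractor_sub_closure hg hA AO gO.
  (* Forward invariance keeps the orbit in [O], so the preimage property can be iterated letter by
     letter. *)
  have pre w x : O x -> O (word_map g w x) /\ (A (word_map g w x) -> A x).
    move=> Ox; elim: w => //= i w [Ow IH]; split.
      by apply: (gO i); exists (word_map g w x).
    by move=> /(attractor_preimage hg hA oO OOm AclO gdisj Ow).
  have sym w : symmetry A D (word_map g w).
    split=> //.
      by apply/holomorphic_onP => z /DO/OOm; exact: (word_map_cdiffable hg).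
    move=> x Dx; split=> [[_ Ax]|[_ Awx]]; split=> //.
      + exact: (word_map_attractor hA).
    + exact: (pre w x (DO _ Dx)).2.
  split=> [w _|a [Da Aa] S /nbhsCP[e e0 HS]]; first exact: sym.
  have oD : open D by case: domD.
  have [rho rho0 Hrho] := (open_discP D).1 oD _ Da.
  (* The radius places the fixed point both in [S] and in [D]. *)
  have er0 : 0 < Num.min e rho by rewrite lt_min e0.
  have [w [b [w0 Ab wb]]] := dense_fixed_points hg hA Aa er0.
  rewrite lt_min => /andP[be /Hrho Db]; exists b; split; last exact: HS.
  split=> //; split=> //; exists D, (word_map g w); split; first exact: sym.
  by split=> //; exact: (word_map_attracting hg hA).
Qed.
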